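(* Let $(X,\mathscr{A},\mu,T)$ and $(Y,\mathscr{B},\nu,S)$ be two dynamical systems. Then there always exists a maximum $T$-factor $\sigma$-algebra of $S$, denoted by $\mathscr{F}_T$ (that is, a $T$-factor $\sigma$-algebra of $S$ which contains, modulo $\nu$, every $T$-factor $\sigma$-algebra of $S$). Moreover, under any joining $\lambda$ of $T$ and $S$, the $\sigma$-algebras $\mathscr{A}\otimes\{\emptyset,Y\}$ and $\{\emptyset,X\}\otimes\mathscr{B}$ are independent conditionally to the $\sigma$-algebra $\{\emptyset,X\}\otimes\mathscr{F}_T$.
   Context: A dynamical system $(X,\mathscr{A},\mu,T)$ consists of a Lebesgue space (equivalently, a standard Borel space with a probability measure $\mu$) and an automorphism $T$ of it: $T$ is an invertible bi-measurable transformation preserving $\mu$. Measurable sets are identified when they differ by a null set. A joining of $T$ and $S$ is a probability measure on $X\times Y$ with marginals $\mu$ and $\nu$, invariant under $T\times S$. More generally, a joining of a finite or countable family of systems $(T_i)_{i\in I}$ is a probability measure on the product space, invariant under the product transformation, whose marginal on each coordinate is the corresponding invariant measure; it defines a dynamical system. A system $(Z,\mathscr{C},\rho,R)$ is a factor of $(Y,\mathscr{B},\nu,S)$ if there is a homomorphism $\pi:Y\to Z$, i.e. a measurable map with $\pi(\nu)=\rho$ and $\pi\circ S=R\circ\pi$; the associated factor $\sigma$-algebra is $\pi^{-1}(\mathscr{C})$. Factor $\sigma$-algebras of $S$ are, modulo $\nu$, exactly the sub-$\sigma$-algebras of $\mathscr{B}$ invariant under $S$ and $S^{-1}$. A $T$-factor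 of $S$ is any common factor of $S$ with a joining of countably many copies of $T$ (i.e. a system which is a factor of $S$ and also a factor of the system defined by some joining of a countable family of copies of $T$). A $T$-factor $\sigma$-algebra of $S$ is any factor $\sigma$-algebra of $S$ associated to a $T$-factor of $S$. *)

(* Defs.v *)
From HB Require Import structures.
From mathcomp Require Import all_boot all_order all_algebra.
From mathcomp Require Import all_classical all_reals all_analysis.

Set Implicit Arguments.
Unset Strict Implicit.
Unset Printing Implicit Defensive.

Import Order.TTheory GRing.Theory Num.Theory.
Import numFieldNormedType.Exports.

Local Open Scope classical_set_scope.
Local Open Scope ring_scope.
Local Open Scope ereal_scope.

Definition polish (R : realType) (M : metricType R) : Prop :=
  (forall u : nat -> M, cauchy (u @ \oo) -> exists x : M, u @ \oo --> x) /\
  (exists2 D : set M, countable D & dense D).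

Definition standard_borel (R : realType) (d : measure_display)
    (X : measurableType d) : Prop :=
  exists (M : metricType R) (f : X -> M),
    [/\ polish M, bijective f &
        forall A : set X, measurable A <-> <<s (@open M) >> (f @` A)].

Definition automorphism (R : realType) (d : measure_display)
    (X : measurableType d) (mu : probability X R) (T : X -> X) : Prop :=
  exists T' : X -> X,
    [/\ cancel T T', cancel T' T,
        measurable_fun setT T, measurable_fun setT T' &
        forall A : set X, measurable A -> mu (T @^-1` A) = mu A].

Definition dynamical_system (R : realType) (d : measure_display)
    (X : measurableType d) (mu : probability X R) (T : X -> X) : Prop :=
  standard_borel R X /\ automorphism mu T.

Definition joining (R : realType) (dX dY : measure_display)
    (X : measurableType dX) (Y : measurableType dY)
    (mu : probability X R) (T : X -> X) (nu : probability Y R) (S : Y -> Y)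
    (la : probability (X * Y)%type R) : Prop :=
  [/\ forall A : set X, measurable A -> la (fst @^-1` A) = mu A,
      forall B : set Y, measurable B -> la (snd @^-1` B) = nu B &
      forall C : set (X * Y), measurable C ->
        la ((fun p => (T p.1, S p.2)) @^-1` C) = la C].

Definition cylinder (I : countType) (d : measure_display)
    (X : measurableType d) : set (set (I -> X)) :=
  [set A | exists (i : I) (B : set X),
             measurable B /\ A = (fun x : I -> X => x i) @^-1` B].

(* The power X^I, with the sigma-algebra generated by the coordinates. *)
Notation power_space I X := (g_sigma_algebraType (@cylinder I _ X)).

Definition power_map (I X : Type) (T : X -> X) (x : I -> X) : I -> X :=
  fun i => T (x i).

(* I : countType is finite or countably infinite. *)
Definition joining_of_copies (R : realType) (d : measure_display)
    (X : measurableType d) (mu : probability X R) (T : X -> X) (I : countType)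
    (m : probability (power_space I X) R) : Prop :=
  (forall (i : I) (A : set X), measurable A ->
     m ((fun x : I -> X => x i) @^-1` A) = mu A) /\
  (forall C : set (power_space I X), measurable C ->
     m (@power_map I X T @^-1` C) = m C).

Definition factor_map (R : realType) (dY dZ : measure_display)
    (Y : measurableType dY) (Z : measurableType dZ)
    (nu : probability Y R) (S : Y -> Y) (rho : probability Z R) (Q : Z -> Z)
    (pi : Y -> Z) : Prop :=
  [/\ measurable_fun setT pi,
      forall C : set Z, measurable C -> nu (pi @^-1` C) = rho C &
      forall y : Y, pi (S y) = Q (pi y)].

Definition T_factor (R : realType) (dX dY dZ : measure_display)
    (X : measurableType dX) (Y : measurableType dY) (Z : measurableType dZ)
    (mu : probability X R) (T : X -> X) (nu : probability Y R) (S : Y -> Y)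
    (rho : probability Z R) (Q : Z -> Z) : Prop :=
  (exists pi : Y -> Z, factor_map nu S rho Q pi) /\
  (exists (I : countType) (m : probability (power_space I X) R)
     (q : power_space I X -> Z),
     joining_of_copies mu T m /\ factor_map m (@power_map I X T) rho Q q).

Definition T_factor_sigma_algebra (R : realType) (dX dY : measure_display)
    (X : measurableType dX) (Y : measurableType dY)
    (mu : probability X R) (T : X -> X) (nu : probability Y R) (S : Y -> Y)
    (F : set (set Y)) : Prop :=
  exists (dZ : measure_display) (Z : measurableType dZ)
    (rho : probability Z R) (Q : Z -> Z) (pi : Y -> Z),
    [/\ dynamical_system rho Q,
        T_factor mu T nu S rho Q,
        factor_map nu S rho Q pi &
        F = preimage_set_system setT pi measurable].

Definition sub_mod (R : realType) (d : measure_display)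
    (Y : measurableType d) (nu : probability Y R) (F G : set (set Y)) : Prop :=
  forall A : set Y, F A ->
    exists2 B : set Y, G B & nu ((A `\` B) `|` (B `\` A)) = 0.

Definition max_T_factor_sigma_algebra (R : realType)
    (dX dY : measure_display) (X : measurableType dX) (Y : measurableType dY)
    (mu : probability X R) (T : X -> X) (nu : probability Y R) (S : Y -> Y)
    (F : set (set Y)) : Prop :=
  T_factor_sigma_algebra mu T nu S F /\
  (forall G : set (set Y),
     T_factor_sigma_algebra mu T nu S G -> sub_mod nu G F).

(* f is a version of the conditional probability P(A | G), for a
   sub-sigma-algebra G of the measurable sets. *)
Definition cond_prob (R : realType) (d : measure_display)
    (O : measurableType d) (P : probability O R) (G : set (set O))
    (A : set O) (f : O -> R) : Prop :=
  [/\ preimage_set_system setT f measurable `<=` G,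
      P.-integrable setT (EFin \o f) &
      forall C : set O, G C -> \int[P]_(x in C) (f x)%:E = P (A `&` C)].

(* Versions of conditional probabilities exist and agree almost everywhere,
   so the choice of versions is immaterial. *)
Definition cond_independent (R : realType) (d : measure_display)
    (O : measurableType d) (P : probability O R)
    (A1 A2 G : set (set O)) : Prop :=
  forall E1 E2 : set O, A1 E1 -> A2 E2 ->
    exists f1 f2 f12 : O -> R,
      [/\ cond_prob P G E1 f1, cond_prob P G E2 f2,
          cond_prob P G (E1 `&` E2) f12 &
          {ae P, forall x, f12 x = (f1 x * f2 x)%R}].

(* Main.v *)
Require Import Defs.
From HB Require Import structures.
From mathcomp Require Import all_boot all_order all_algebra.
From mathcomp Require Import all_classical all_reals all_analysis.
From mathcomp Require Import measurable_realfun.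
From mathcomp Require Import ring lra.

Set Implicit Arguments.
Unset Strict Implicit.
Unset Printing Implicit Defensive.

Import Order.TTheory GRing.Theory Num.Theory.
Import numFieldNormedType.Exports.

Local Open Scope classical_set_scope.
Local Open Scope ring_scope.

(** Fix a joining [la] of [T] and [S] and a measurable set [A] of [X], and let
    [f y] be the conditional probability of [A] given the second coordinate
    [y].  Draw [y] from [nu] and then infinitely many conditionally independent
    points [x_0, x_1, ...] from the conditional law of [x] given [y].  The
    conditional law intertwines [T] and [S], because [la] is invariant, so the
    law of the sequence [(x_k)] is a joining of countably many copies of [T],
    and the law of [((x_k), y)] is a joining of that system with [S].  By the
    law of large numbers the averages of the indicator of [A] along [(x_k)]
    converge to [f y].  Hence [f] is at the same time a function on [Y] and a
    function on a joining of copies of [T], and the process of its values along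
    an orbit is a common factor of both systems ([cond_law_T_factor]).  So [f]
    is measurable, modulo [nu], with respect to any maximum T-factor
    sigma-algebra, and saying that the conditional probability of [A] given [Y]
    only depends on a factor of [Y] is saying that [X] and [Y] are conditionally
    independent over that factor ([cond_independent_of_factor]).

    The same construction gives the maximum.  A set [B] of [Y] that belongs to
    some T-factor sigma-algebra can be recovered, up to a null set, from a
    random point of a joining of copies of [T] sampled conditionally on [y]
    ([T_factor_recovered]).  The space of measurable sets is separable, so there
    are countably many recovered sets [B_k] that are dense among all of them
    ([exists_dense_recovered]).  Sampling all the corresponding points
    conditionally independently given [y] produces one joining of countably many
    copies of [T] from which all [B_k] are recovered; the orbit process of
    [(B_k)] is therefore a T-factor, and its sigma-algebra, being closed under
    almost sure limits, contains modulo [nu] every limit of sets [B_k]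
    ([exists_max_T_factor]).

    Three devices make this concrete.  A standard Borel space is a measurable
    retract of the real line ([standard_borel_coded]), which allows every factor
    to be realised on the line by coding a countable family of reals as one
    real.  Conditional laws are realised by noise outsourcing: a pair [(w, z)]
    is distributed as [(phi (z, u), z)] with [u] uniform and independent of [z]
    ([noise_outsourcing]), [phi] being the conditional quantile function.
    Conditionally independent samples then come from independent uniform
    variables, all read off a single one ([exists_iid_uniform]). *)

(** * Reals determined by countably many comparisons with rationals *)

Lemma measurable_lt_set (R : realType) d (O : measurableType d) (f g : O -> R) :
  measurable_fun setT f -> measurable_fun setT g ->
  measurable [set w | f w < g w].
Proof.
move=> mf mg; have := measurable_fun_ltr mf mg measurableT (Y := [set true]) I.
by rewrite setTI.
Qed.

Lemma measurable_le_set (R : realType) d (O : measurableType d) (f g : O -> R) :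
  measurable_fun setT f -> measurable_fun setT g ->
  measurable [set w | f w <= g w].
Proof.
move=> mf mg; have := measurable_fun_ler mf mg measurableT (Y := [set true]) I.
by rewrite setTI.
Qed.

Lemma measurable_neq_set (R : realType) d (O : measurableType d) (f g : O -> R) :
  measurable_fun setT f -> measurable_fun setT g ->
  measurable [set w | f w != g w].
Proof.
move=> mf mg.
rewrite (_ : mkset _ = ~` ([set w | f w <= g w] `&` [set w | g w <= f w])).
  by apply: measurableC; apply: measurableI; exact: measurable_le_set.
apply/seteqP; split => w /=.
  by move=> /negP + [h1 h2]; apply; rewrite eq_le h1 h2.
by move=> h; apply/negP; rewrite eq_le => /andP[]; move=> h1 h2; apply: h.
Qed.

(** The infimum is the value of the cut.  Encoding a real by the rationals above
    it makes measurability a matter of countably many events, and the encoding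
    is insensitive to whether the cut contains its own end point. *)
Definition real_of_cut (R : realType) (C : set rat) : R :=
  fine (ereal_inf [set (ratr q)%:E | q in C]).

Lemma real_of_cutE (R : realType) (C : set rat) (x : R) :
  (forall q, x < ratr q -> C q) -> (forall q, C q -> x <= ratr q) ->
  real_of_cut R C = x.
Proof.
move=> xC Cx; rewrite /real_of_cut (_ : ereal_inf _ = x%:E)//.
apply/eqP; rewrite eq_le; apply/andP; split; last first.
  by apply: le_ereal_inf_tmp => _ [q /Cx xq <-]; rewrite lee_fin.
apply/lee_addgt0Pr => e e0; rewrite -EFinD.
have xe : x < x + e by rewrite ltrDl.
have [q] := rat_in_itvoo xe; rewrite in_itv/= => /andP[xq qe].
apply: (@le_trans _ _ (ratr q)%:E); last by rewrite lee_fin ltW.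
by apply: ereal_inf_lbound; exists q => //; exact: xC.
Qed.

Lemma measurable_real_of_cut (R : realType) d (O : measurableType d)
    (C : O -> set rat) : (forall q, measurable [set w | C w q]) ->
  measurable_fun setT (fun w => real_of_cut R (C w)).
Proof.
move=> mC; apply: (measurableT_comp (fine_measurable measurableT)).
apply: (@measurability _ _ _ _ _ _ _ (ErealGenInftyO.measurableE R)).
move=> _ -[_ [a ->] <-]; rewrite setTI.
rewrite [X in measurable X](_ : _ =
    \bigcup_q [set w | C w q /\ (ratr q : R) < a]).
  apply: bigcupT_measurable_rat => q.
  have [qa|qa] := boolP (ratr q < a).
    by rewrite (_ : [set w | _] = [set w | C w q])//; apply/seteqP; split => w //= -[].
  rewrite (_ : [set w | _] = set0)//; apply/seteqP; split => w //= -[_] h.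
  by move/negP: qa; apply.
apply/seteqP; split => w /=; rewrite in_itv/=.
  move=> /ereal_inf_lt[_ [q Cq <-]]; rewrite lte_fin => qa.
  by exists q.
move=> [q _ [Cq qa]]; apply: (@le_lt_trans _ _ (ratr q)%:E).
  by apply: ereal_inf_lbound; exists q.
by rewrite lte_fin.
Qed.

(** The infimum need not be attained, but being strictly below [a] is witnessed
    by one rational; this is what turns events about the value of a cut into
    countable unions. *)
Lemma real_of_cut_lt (R : realType) (C : set rat) (b a : R) :
  C !=set0 -> (forall q, C q -> b <= ratr q) ->
  (real_of_cut R C < a <-> exists2 q, C q & ratr q < a).
Proof.
move=> [q0 Cq0] Cb; rewrite /real_of_cut.
set S := [set (ratr q : R)%:E | q in C].
have lb : (b%:E <= ereal_inf S)%E.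
  by apply: le_ereal_inf_tmp => _ [q /Cb bq <-]; rewrite lee_fin.
have ub q : C q -> (ereal_inf S <= (ratr q)%:E)%E.
  by move=> Cq; apply: ereal_inf_lbound; exists q.
have fin : ereal_inf S \is a fin_num.
  by rewrite fin_numElt (lt_le_trans _ lb) ?ltNyr// (le_lt_trans (ub _ Cq0)) ?ltry.
rewrite -lte_fin fineK//; split.
  by move=> /ereal_inf_lt[_ [q Cq <-]]; rewrite lte_fin; exists q.
by move=> [q Cq qa]; apply: (le_lt_trans (ub q Cq)); rewrite lte_fin.
Qed.

(** A limit operation defined on all sequences: the upper limit, except for junk
    values when it is infinite.  As a cut it is measurable by construction. *)
Definition limit_from_above (R : realType) (s : nat -> R) : R :=
  real_of_cut R [set q | exists J, forall j, (J <= j)%N -> s j < ratr q].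

(** The geometric rate of convergence is what Borel-Cantelli provides. *)
Lemma limit_from_aboveE (R : realType) (s : nat -> R) (p : R) :
  (exists J, forall j, (J <= j)%N -> `|s j - p| < 2 ^- j) ->
  limit_from_above s = p.
Proof.
move=> [J hJ].
have small e : 0 < e -> exists2 K, (J <= K)%N & forall j, (K <= j)%N -> (2 ^- j : R) < e.
  move=> e0; have half : `|2^-1 : R| < 1 by rewrite ger0_norm ?invf_lt1 ?ltr1n//; lra.
  have /cvgrPdist_lt/(_ e e0)[K _ hK] := cvg_geometric (1 : R) half.
  exists (maxn J K); first exact: leq_maxl.
  move=> j Kj; have /= := hK j (leq_trans (leq_maxr _ _) Kj).
  by rewrite sub0r normrN /geometric/= mul1r exprVn ger0_norm ?invr_ge0 ?exprn_ge0.
apply: real_of_cutE => q.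
  move=> pq; have [K JK hK] := small (ratr q - p) (ltac:(rewrite subr_gt0//)).
  exists K => j Kj; have := hJ j (leq_trans JK Kj); have := hK j Kj.
  by rewrite ltr_norml => h1 /andP[_ h2]; lra.
move=> [K hK]; apply/ler_addgt0Pr => e e0.
have [K' JK' hK'] := small e e0.
have := hK _ (leq_maxl K K'); have := hJ _ (leq_trans JK' (leq_maxr K K')).
have := hK' _ (leq_maxr K K'); rewrite ltr_norml.
by move=> h1 /andP[h2 _] h3; lra.
Qed.

Lemma measurable_limit_from_above (R : realType) d (O : measurableType d)
    (s : nat -> O -> R) : (forall j, measurable_fun setT (s j)) ->
  measurable_fun setT (fun w => limit_from_above (fun j => s j w)).
Proof.
move=> ms; apply: measurable_real_of_cut => q.
rewrite (_ : mkset _ = \bigcup_J \bigcap_(j in [set j | (J <= j)%N])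
   [set w | s j w < ratr q]).
  apply: bigcupT_measurable => J; apply: bigcap_measurable; first by exists J => /=.
  by move=> j _; exact: measurable_lt_set.
apply/seteqP; split => w /=; first by move=> [J h]; exists J.
by move=> [J _ h]; exists J.
Qed.

(** A monotone cofinal sequence below [a] reduces an event of the form
    [f < a] to an increasing union of events at rational levels, to which
    continuity of measures from below applies. *)
Lemma exists_rat_ladder (R : realType) (a : R) : exists r : nat -> rat,
  [/\ forall n, r n <= r n.+1, forall n, ratr (r n) < a &
      forall q, ratr q < a -> exists n, q <= r n].
Proof.
have a1 : a - 1 < a by rewrite gtrBl.
have [q0] := rat_in_itvoo a1; rewrite in_itv/= => /andP[_ q0a].
pose r := fix r n : rat := if n is m.+1 then
  (if (unpickle m : option rat) is Some q then
     if (ratr q : R) < a then Order.max (r m) q else r m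
   else r m) else q0.
exists r; split.
- move=> n /=; case: unpickle => // q; case: ifP => // _.
  by rewrite le_max lexx.
- elim=> // n IH /=; case: unpickle => // q; case: ifP => // qa.
  by rewrite maxEle; case: ifP.
- move=> q qa; exists (pickle q).+1.
  by rewrite /= pickleK qa le_max lexx orbT.
Qed.

(** * Coding sequences of reals by one real; standard Borel spaces *)

(** Base 4 with digits 0 and 1 only: the digits after the n-th contribute less
    than half a unit of the n-th place, so that no carry can occur and the n-th
    digit is the parity of the integer part of [4 ^+ n.+1 * t].  Base 2 would
    be ambiguous at dyadic numbers. *)
Definition encode_bits (R : realType) (c : set nat) : R :=
  limn (fun n => \sum_(k < n) (\1_c k : R) / 4 ^+ k.+1).

Definition decode_bits (R : realType) (t : R) : set nat :=
  [set k | exists n : nat, odd n /\ n%:R <= 4 ^+ k.+1 * t < n.+1%:R].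

Section encode_bits.
Variables (R : realType) (c : set nat).

Let s (n : nat) : R := \sum_(k < n) (\1_c k : R) / 4 ^+ k.+1.
(* the integer whose base 4 expansion is the first [n] digits *)
Let N := fix N n : nat := if n is m.+1 then (N m * 4 + (m \in c))%N else 0%N.

Let sS n : s n.+1 = s n + (\1_c n : R) / 4 ^+ n.+1.
Proof. by rewrite /s big_ord_recr. Qed.

Let sN n : 4 ^+ n * s n = (N n)%:R.
Proof.
elim: n => [|n IH]; first by rewrite /s big_ord0 mulr0.
rewrite sS mulrDr mulrCA divff ?expf_neq0 ?pnatr_eq0// mulr1 exprS -mulrA IH.
by rewrite indicE /= natrD natrM mulrC.
Qed.

Let s_nd : nondecreasing_seq s.
Proof.
apply/nondecreasing_seqP => n; rewrite sS lerDl divr_ge0 ?exprn_ge0//.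
Qed.

(* [(3 * 4 ^+ n)^-1] is the sum of all the remaining places filled with 1 *)
Let s_ub n m : (n <= m)%N -> s m + (3 * 4 ^+ m)^-1 <= s n + (3 * 4 ^+ n)^-1.
Proof.
move=> /subnK <-; elim: (m - n)%N => [//|k IH].
apply: le_trans IH; rewrite addSn sS -addrA lerD2l exprS.
have : (\1_c (k + n)%N : R) <= 1 by rewrite indicE; case: (_ \in _).
have p : 0 < (4 ^+ (k + n) : R) by rewrite exprn_gt0.
set e := _ ^+ _ in p *; move=> /(ler_wpM2r _) => /(_ (4 * e)^-1) h.
apply: (@le_trans _ _ (1 * (4 * e)^-1 + (3 * (4 * e))^-1)).
  by rewrite lerD2r; apply: h; rewrite invr_ge0 mulr_ge0// ltW.
by rewrite le_eqVlt; apply/orP; left; apply/eqP; field; lra.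
Qed.

Lemma is_cvg_encode_bits :
  cvgn (fun n => \sum_(k < n) (\1_c k : R) / 4 ^+ k.+1).
Proof.
apply: (@nondecreasing_is_cvgn _ s) => //; exists (s 0 + (3 * 4 ^+ 0)^-1) => _ [n _ <-].
by apply: le_trans (s_ub (leq0n n)); rewrite lerDl invr_ge0 mulr_ge0// exprn_ge0.
Qed.

Let lim_bounds n : s n <= encode_bits R c < s n + (2 * 4 ^+ n)^-1.
Proof.
have p : 0 < (4 ^+ n : R) by rewrite exprn_gt0.
apply/andP; split; first exact: (nondecreasing_cvgn_le s_nd is_cvg_encode_bits).
apply: (@le_lt_trans _ _ (s n + (3 * 4 ^+ n)^-1)); last first.
  by rewrite ltrD2l ltf_pV2 ?posrE ?mulr_gt0// ltr_pM2r// ltr_nat.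
apply: limr_le; first exact: is_cvg_encode_bits.
near=> m.
apply: le_trans (@s_ub n m _); last by near: m; exact: nbhs_infty_ge.
by rewrite lerDl invr_ge0 mulr_ge0// exprn_ge0.
Unshelve. all: by end_near. Qed.

Lemma encode_bits_itv : 0 <= encode_bits R c < 1.
Proof.
have := lim_bounds 0; rewrite /s big_ord0 expr0 mulr1 add0r => /andP[-> /=].
by move=> /lt_trans; apply; rewrite invf_lt1// ltr1n.
Qed.

Lemma encode_bitsK : decode_bits (encode_bits R c) = c.
Proof.
have bnd k : (N k.+1)%:R <= 4 ^+ k.+1 * encode_bits R c < (N k.+1).+1%:R.
  have p : 0 < (4 ^+ k.+1 : R) by rewrite exprn_gt0.
  have /andP[l u] := lim_bounds k.+1.
  have := sN k.+1; move: (N k.+1) => M sM.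
  rewrite -(@natr1 _ M) -sM ler_pM2l// l/=.
  rewrite -ltr_pdivlMl// (lt_le_trans u)// mulrDr mulKf ?gt_eqF//.
  by rewrite lerD2l mulr1 lef_pV2 ?posrE ?mulr_gt0// ler_peMl ?ler1n// ltW.
have oN k : odd (N k.+1) = (k \in c) by rewrite /= oddD oddM andbF/=; case: (_ \in _).
apply/seteqP; split => k /=.
  move=> [n [on /andP[nl nu]]]; have /andP[l u] := bnd k.
  suff nN : n = N k.+1 by have := oN k; rewrite -nN on => /esym/set_mem.
  apply/eqP; rewrite eqn_leq; apply/andP; split; rewrite -ltnS -(ltr_nat R).
    exact: le_lt_trans nl u.
  exact: le_lt_trans l nu.
by move=> ck; exists (N k.+1); split; [rewrite oN mem_set|exact: bnd].
Qed.

End encode_bits.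

Lemma measurable_encode_bits (R : realType) d (O : measurableType d)
    (c : O -> set nat) : (forall k, measurable [set w | c w k]) ->
  measurable_fun setT (fun w => encode_bits R (c w)).
Proof.
move=> mc.
apply: (measurable_fun_cvg
  (h := fun n w => \sum_(k < n) (\1_(c w) k : R) / 4 ^+ k.+1)).
  move=> n; apply: measurable_sum => k; apply: measurable_funM => //.
  apply: (eq_measurable_fun (\1_[set w | c w k] : O -> R)) => [w _|].
    by rewrite !indicE; congr (_ %:R); congr nat_of_bool; apply/idP/idP; rewrite !inE.
  exact: measurable_indic.
move=> w _; exact: is_cvg_encode_bits.
Qed.

Lemma measurable_decode_bits (R : realType) k :
  measurable [set t : R | decode_bits t k].
Proof.
rewrite (_ : [set t | _] = \bigcup_(n in [set n | odd n])
   ((fun t => 4 ^+ k.+1 * t) @^-1` `[n%:R, n.+1%:R[%classic)).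
  apply: bigcup_measurable => n _; rewrite -[X in measurable X]setTI.
  by apply: mulrl_measurable => //; exact: measurable_itv.
apply/seteqP; split => t /=.
  by move=> [n [on h]]; exists n => //=; rewrite in_itv.
by move=> [n on /=]; rewrite in_itv/= => h; exists n.
Qed.

Section power_space.
Context (I : countType) d (X : measurableType d).

Lemma measurable_cylinder (i : I) (A : set X) : measurable A ->
  measurable ((fun x : power_space I X => x i) @^-1` A).
Proof. by move=> mA; apply: sub_sigma_algebra; exists i, A. Qed.

Lemma measurable_coord (i : I) :
  measurable_fun setT (fun x : power_space I X => x i).
Proof. by move=> _ A mA; rewrite setTI; exact: measurable_cylinder. Qed.

Lemma measurable_fun_power d' (O : measurableType d') (f : O -> power_space I X) :
  (forall i, measurable_fun setT (fun w => f w i)) -> measurable_fun setT f.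
Proof.
move=> mf.
apply: (@measurability _ _ O (power_space I X) setT f (@cylinder I d X)) => //.
move=> _ [_ [i [A [mA ->]]] <-]; rewrite setTI.
by have := mf i measurableT A mA; rewrite setTI.
Qed.

Lemma measurable_power_map (T : X -> X) : measurable_fun setT T ->
  measurable_fun setT (@power_map I X T : power_space I X -> power_space I X).
Proof.
move=> mT; apply: measurable_fun_power => i.
exact: (measurableT_comp mT (measurable_coord i)).
Qed.

End power_space.

Section encode_family.
Variables (R : realType) (I : countType).

(** Bits record, for every index and every rational, whether the coordinate lies
    below that rational; each coordinate is read back as a cut. *)
Definition encode_family (a : I -> R) : R :=
  encode_bits R [set k | exists2 p : I * rat, unpickle k = Some p & a p.1 < ratr p.2].

Definition decode_family (t : R) (i : I) : R :=
  real_of_cut R [set q | decode_bits t (pickle (i, q))].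

Lemma encode_familyK (a : I -> R) : decode_family (encode_family a) = a.
Proof.
apply/funext => i; rewrite /decode_family encode_bitsK.
apply: real_of_cutE => q /=.
  by move=> aq; exists (i, q) => //; rewrite pickleK.
by rewrite pickleK => -[p [<-] /= /ltW].
Qed.

Lemma measurable_encode_family d (O : measurableType d) (f : O -> I -> R) :
  (forall i, measurable_fun setT (fun w => f w i)) ->
  measurable_fun setT (fun w => encode_family (f w)).
Proof.
move=> mf; apply: measurable_encode_bits => k /=.
case: (unpickle k) => [p|]; last first.
  rewrite (_ : [set w | _] = set0)//.
  by apply/seteqP; split => w //= -[].
rewrite (_ : [set w | _] = [set w | f w p.1 < ratr p.2]).
  have := mf p.1 measurableT _ (measurable_itv `]-oo, (ratr p.2 : R)[).
  by rewrite setTI set_itvE.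
by apply/seteqP; split => w /= => [[_ [<-]]//|h]; exists p.
Qed.

Lemma measurable_decode_family i :
  measurable_fun setT (fun t => decode_family t i).
Proof. by apply: measurable_real_of_cut => q; exact: measurable_decode_bits. Qed.

End encode_family.

(** [W] is a measurable retract of the unit interval.  This is all that is used
    of a standard Borel space: unlike a Borel isomorphism with a Borel subset it
    passes to countable powers at once, and the retraction [r] can be applied to
    any real number. *)
Definition coded (R : realType) d (W : measurableType d) : Prop :=
  exists (e : W -> R) (r : R -> W),
    [/\ measurable_fun setT e, measurable_fun setT r, cancel e r &
        forall w, 0 <= e w < 1].

Lemma coded_prod (R : realType) : coded R (R * R)%type.
Proof.
exists (fun p => encode_family (fun b : bool => if b then p.1 else p.2)).
exists (fun t => (decode_family t true, decode_family t false)); split.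
- apply: measurable_encode_family => -[].
    exact: measurable_fst.
  exact: measurable_snd.
- by apply: measurable_fun_pair; exact: measurable_decode_family.
- by move=> [a b] /=; rewrite encode_familyK.
- by move=> p; exact: encode_bits_itv.
Qed.

Lemma coded_power (R : realType) (I : countType) d (X : measurableType d) :
  coded R X -> coded R (power_space I X).
Proof.
move=> [e [r [me mr er _]]].
exists (fun x => encode_family (fun i => e (x i))).
exists (fun t i => r (decode_family t i)); split.
- apply: measurable_encode_family => i.
  exact: (measurableT_comp me (measurable_coord i)).
- apply: measurable_fun_power => i.
  exact: (measurableT_comp mr (measurable_decode_family i)).
- by move=> x /=; apply/funext => i; rewrite encode_familyK er.
- by move=> x; exact: encode_bits_itv.
Qed.

Lemma standard_borel_R (R : realType) : standard_borel R R.
Proof.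
exists R^o, id; split.
- split; first by move=> u uc; apply/cvg_ex; exact: (R_complete _ uc).
  exists (range (@ratr R)); first exact: (sub_countable (card_image_le _ _)).
  exact: dense_rat.
- by exists id.
- move=> A; rewrite image_id; split.
    have -> : measurable A = <<s [set A : set R | exists x y, A = `]x, y[%classic] >> A.
      exact: (congr1 (fun M => M A) (RGenOpens.measurableE R)).
    apply: sub_sigma_algebra2 A.
    by move=> _ [x [y ->]]; exact: (@interval_open R (BRight x) (BLeft y)).
  move: A; apply: smallest_sub; first exact: sigma_algebra_measurable.
  by move=> A; exact: open_measurable.
Qed.

Lemma open_mball (R : realType) (M : metricType R) (x : M) (e : R) :
  open [set y | mdist y x < e].
Proof.
rewrite openE => y /= yx; apply/nbhs_ballP; exists (e - mdist y x) => /=.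
  by rewrite subr_gt0.
move=> z; rewrite ballEmdist/= metric_sym ltrBrDr; apply: le_lt_trans.
exact: metric_triangle.
Qed.

(** A point is determined by its distances to a dense sequence [p], and the
    sequences [t] of distances that occur are singled out by countably many
    conditions on countably many coordinates.  If [t] satisfies them, the points
    [p n] with [t n] small form a Cauchy sequence, whose limit has distances
    [t]; this is where completeness enters. *)
Lemma polish_coordinates (R : realType) (M : metricType R) (x0 : M) :
  polish M -> exists p : nat -> M,
    (forall x e, 0 < e -> exists n, mdist x (p n) < e) /\
    (forall t : nat -> R,
      (forall k : nat, exists n, t n < k.+1%:R^-1) ->
      (forall n m, `|t n - t m| <= mdist (p n) (p m) <= t n + t m) ->
      exists x, forall n, mdist x (p n) = t n).
Proof.
move=> [cM [D /countable_injP[i iinj] dD]].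
pose p n := xget x0 [set x | D x /\ i x = n].
have pd x e : 0 < e -> exists n, mdist x (p n) < e.
  move=> e0; have [||y [/= yx Dy]] := dD [set y | mdist y x < e].
  - by exists x; rewrite /= mdistxx.
  - exact: open_mball.
  exists (i y); suff -> : p (i y) = y by rewrite metric_sym.
  rewrite /p; case: xgetP => [z _ [Dz iz]|/(_ y)]; last by case.
  by apply: iinj; rewrite ?inE.
exists p; split=> // t t0 tp.
have [n tn] := choice t0.
have t_ge0 m : 0 <= t m.
  have /andP[+ _] := tp m m; rewrite subrr normr0 => _.
  by have /andP[_] := tp m m; rewrite mdistxx -mulr2n pmulrn_lge0.
have [x xlim] : exists x : M, (fun k => p (n k)) @ \oo --> x.
  apply: cM; apply: cauchy_exP => e e0.
  have e2 : 0 < e / 2 by rewrite divr_gt0.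
  have [N _ hN] := near_infty_natSinv_lt (PosNum e2).
  exists (p (n N)); exists N => // k /= Nk.
  rewrite ballEmdist/=.
  have /andP[_ h] := tp (n N) (n k); apply: (le_lt_trans h).
  rewrite [e]splitr ltrD//.
    by apply: (lt_trans (tn N)); exact: hN N (leqnn N).
  by apply: (lt_trans (tn k)); exact: hN k Nk.
exists x => m; apply/eqP; rewrite -subr_eq0 -normr_le0; apply/ler_addgt0Pr => e e0.
rewrite add0r.
have e2 : 0 < e / 2 by rewrite divr_gt0.
have [K1 _ hK1] := cvg_ball xlim e2.
have [K2 _ hK2] := near_infty_natSinv_lt (PosNum e2).
pose k := maxn K1 K2.
have := hK1 k (leq_maxl _ _); rewrite ballEmdist/= => xk.
have tk : t (n k) < e / 2 by apply: lt_trans (tn k) _; exact: hK2 k (leq_maxr _ _).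
have /andP[lo up] := tp (n k) m.
have := lo; rewrite ler_norml => /andP[lo1 lo2].
have tri1 := metric_triangle x (p (n k)) (p m).
have tri2 := metric_triangle (p (n k)) x (p m).
rewrite (metric_sym (p (n k)) x) in tri2.
by rewrite ler_norml; apply/andP; split; lra.
Qed.

(** The code of a point is the code of its distances to a dense sequence.  The
    set [J] of the reals that decode to the distances of a point is Borel by
    [polish_coordinates], so the decoding map can be sent to a constant outside
    [J] and remains measurable. *)
Lemma standard_borel_coded (R : realType) d (X : measurableType d) :
  standard_borel R X -> coded R X.
Proof.
move=> [M [f [pM [g fK gK] mX]]].
have [p [pd pt]] := polish_coordinates (f point) pM.
pose a x n := mdist (f x) (p n).
have a_inj x y : a x = a y -> x = y.
  move=> axy; apply: (can_inj fK); apply: mdist_positivity.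
  apply/eqP; rewrite -normr_le0 ger0_norm ?mdist_ge0//; apply/ler_addgt0Pr => e e0.
  rewrite add0r; have e2 : 0 < e / 2 by rewrite divr_gt0.
  have [n xn] := pd (f x) _ e2.
  have yn : mdist (f y) (p n) < e / 2 by have := congr1 (@^~ n) axy; rewrite /a => <-.
  apply: (le_trans (metric_triangle _ (p n) _)); rewrite [e]splitr ltW// ltrD//.
  by rewrite metric_sym.
have f_im B : f @` (f @^-1` B) = B.
  apply/seteqP; split => [_ [x Bx <-]//|y By]; exists (g y); last exact: gK.
  by rewrite /= gK.
have mball n e : measurable [set x | a x n < e].
  by apply/mX; rewrite (f_im [set y | mdist y (p n) < e]); apply: sub_sigma_algebra;
     exact: open_mball.
pose e x := encode_family (a x).
have me : measurable_fun setT e.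
  apply: measurable_encode_family => n.
  apply: (measurability _ (RGenInftyO.measurableE R)).
  move=> _ [_ [x ->] <-]; rewrite setTI set_itvE; exact: mball.
pose dt (t : R) (n : nat) : R := decode_family t n.
pose J := [set t : R |
  (forall k : nat, exists n, dt t n < k.+1%:R^-1) /\
  (forall n m : nat, `|dt t n - dt t m| <= mdist (p n) (p m)
      <= dt t n + dt t m)].
have mdt n : measurable_fun setT (dt^~ n) by exact: measurable_decode_family.
have mJ : measurable J.
  rewrite (_ : J = (\bigcap_k \bigcup_n [set t | dt t n < k.+1%:R^-1]) `&`
    \bigcap_n \bigcap_m ([set t | `|dt t n - dt t m| <= mdist (p n) (p m)] `&`
       [set t | mdist (p n) (p m) <= dt t n + dt t m])).
    apply: measurableI.
      apply: bigcapT_measurable => k; apply: bigcupT_measurable => n.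
      exact: measurable_lt_set.
    apply: bigcapT_measurable => n; apply: bigcapT_measurable => m.
    apply: measurableI; apply: measurable_le_set => //.
      by apply: measurableT_comp => //; exact: measurable_funB.
    exact: measurable_funD.
  apply/seteqP; split => [t [t0 tp]|t [t0 tp]]; split.
  - by move=> k _; have [n tn] := t0 k; exists n.
  - by move=> n _ m _; have /andP[] := tp n m.
  - by move=> k; have [n _ tn] := t0 k I; exists n.
  - by move=> n m; apply/andP; exact: tp n I m I.
have /choice[r rE] : forall t, exists x,
    (J t -> a x = dt t) /\ (~ J t -> x = point).
  move=> t; have [[t0 tp]|nJ] := pselect (J t); last by exists point.
  have [y yt] := pt _ t0 tp; exists (g y); split=> [_|[]//].
  by apply/funext => n; rewrite /a gK yt.
have dte x : dt (e x) = a x by exact: encode_familyK.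
have Je x : J (e x).
  rewrite /J /= dte; split.
    by move=> k; apply: pd; rewrite invr_gt0.
  move=> n m; rewrite /a; apply/andP; split.
    have := metric_triangle (f x) (p n) (p m).
    have := metric_triangle (f x) (p m) (p n).
    rewrite (metric_sym (p m)) => h1 h2; rewrite ler_norml; apply/andP; split; lra.
  by rewrite (metric_sym (f x) (p n)); exact: metric_triangle.
have eK : cancel e r by move=> x; apply: a_inj; rewrite (rE _).1 ?dte.
exists e, r; split=> //; last by move=> x; exact: encode_bits_itv.
move=> _ A mA; rewrite setTI.
(* every measurable set is the preimage of a Borel set of codes, because balls
   are, and an open set is a countable union of balls *)
have [A' mA' AA'] : exists2 A', measurable A' & A = e @^-1` A'.
  have /mX : measurable A := mA.
  suff : <<s open >> `<=` [set B | exists2 B', measurable B' & f @^-1` B = e @^-1` B'].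
    move=> h /h[A' mA' fA']; exists A' => //; rewrite -fA'.
    apply/seteqP; split => [x Ax|x [y Ay /(can_inj fK) <-]//]; by exists x.
  apply: smallest_sub.
    split.
    - by exists set0 => //; rewrite !preimage_set0.
    - move=> B [B' mB' BB']; exists (~` B'); first exact: measurableC.
      rewrite setTD; exact: (congr1 setC BB').
    - move=> F hF.
      have /choice[F' /all_and2[mF' FF']] : forall n, exists B',
          measurable B' /\ f @^-1` F n = e @^-1` B'.
        by move=> n; have [B' ? ?] := hF n; exists B'.
      exists (\bigcup_n F' n); first exact: bigcupT_measurable.
      by rewrite !preimage_bigcup; apply: eq_bigcupr.
  move=> B oB /=.
  exists (\bigcup_(nq : nat * rat) [set t |
      [set y | mdist y (p nq.1) < ratr nq.2] `<=` B /\ dt t nq.1 < ratr nq.2]).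
    apply: countable_bigcupT_measurable => // nq.
    have [qB|qB] := pselect ([set y | mdist y (p nq.1) < ratr nq.2] `<=` B).
      rewrite (_ : [set t | _] = [set t | dt t nq.1 < ratr nq.2]).
        exact: measurable_lt_set.
      by apply/seteqP; split => t // [].
    rewrite (_ : [set t | _] = set0)//.
    by apply/seteqP; split => t // [].
  apply/seteqP; split => x /=.
    move=> Bx; move: oB; rewrite openE => /(_ _ Bx) /nbhs_ballP[eps /= eps0 epsB].
    have e2 : 0 < eps / 2 by rewrite divr_gt0.
    have [n xn] := pd (f x) _ e2.
    have [q] := rat_in_itvoo xn; rewrite in_itv/= => /andP[xq qe].
    exists (n, q) => //=; rewrite dte; split=> // y /= yq.
    apply: epsB; rewrite ballEmdist/=.
    apply: (le_lt_trans (metric_triangle _ (p n) _)); rewrite (metric_sym _ y).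
    by rewrite [eps]splitr ltrD// (lt_trans _ qe).
  move=> [[n q] _ /= []]; rewrite dte => nqB h.
  exact: (nqB (f x)).
rewrite (_ : _ @^-1` _ = (J `&` (fun t => encode_family (dt t)) @^-1` A')
   `|` (~` J `&` [set t | A point])).
  apply: measurableU; apply: measurableI => //.
  - rewrite -[X in measurable X]setTI.
    exact: (measurable_encode_family mdt).
  - exact: measurableC.
  - have [Ap|nAp] := pselect (A point).
      rewrite (_ : [set t | _] = setT)//; apply/seteqP; split => //.
    rewrite (_ : [set t | _] = set0)//; apply/seteqP; split => //.
apply/seteqP; split => t /=.
  move=> Art; have [Jt|nJt] := pselect (J t); [left|right]; split=> //.
    by rewrite AA' /= /e (rE t).1 in Art.
  by rewrite -((rE t).2 nJt).
move=> [[Jt h]|[nJt h]].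
  by rewrite AA' /= /e (rE t).1.
by rewrite (rE t).2.
Qed.

(** * The orbit process of a real function *)

Definition zpow (Y : Type) (S S' : Y -> Y) (n : int) : Y -> Y :=
  match n with Posz k => iter k S | Negz k => iter k.+1 S' end.

Lemma zpowS (Y : Type) (S S' : Y -> Y) (n : int) (y : Y) :
  cancel S S' -> zpow S S' (n + 1) y = zpow S S' n (S y).
Proof.
move=> SK; case: n => [n|[|n]].
- by rewrite -PoszD addn1 /= -iterSr.
- by rewrite /= SK.
- have -> : Negz n.+1 + 1 = Negz n by rewrite !NegzE -addn1 PoszD opprD subrK.
  by rewrite /zpow [in RHS]iterSr SK.
Qed.

Section orbit_code.
Variable R : realType.

(** The two-sided shift transported to codes.  Being the identity off the codes,
    it is a measurable bijection of the whole line, hence an automorphism of any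
    shift-invariant law; two-sided sequences are needed for invertibility. *)
Definition shift_code (k : int) (t : R) : R :=
  if encode_family (decode_family (I := int) t) == t then
    encode_family (fun n : int => decode_family t (n + k))
  else t.

Lemma measurable_shift_code k : measurable_fun setT (shift_code k).
Proof.
have mdec (n : int) : measurable_fun setT (fun t : R => decode_family t n).
  exact: measurable_decode_family.
apply: measurable_fun_ifT => //.
- by apply: measurable_fun_eqr => //; exact: measurable_encode_family.
- by apply: measurable_encode_family => n; exact: mdec.
Qed.

Lemma shift_codeE k (c : int -> R) :
  shift_code k (encode_family c) = encode_family (fun n => c (n + k)).
Proof. by rewrite /shift_code encode_familyK eqxx. Qed.

Lemma shift_codeK k : cancel (shift_code k) (shift_code (- k)).
Proof.
move=> t; rewrite {2}/shift_code; case: ifPn => [/eqP tE|tE].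
  rewrite shift_codeE -[RHS]tE; congr encode_family; apply/funext => n.
  by rewrite subrK.
by rewrite /shift_code (negbTE tE).
Qed.

(** The orbit map is a homomorphism from [S] to the shift, and its sigma-algebra
    is the factor sigma-algebra generated by [g]. *)
Definition orbit_code (Y : Type) (S S' : Y -> Y) (g : Y -> R) (y : Y) : R :=
  encode_family (fun n : int => g (zpow S S' n y)).

Lemma orbit_code_equivariant (Y : Type) (S S' : Y -> Y) (g : Y -> R) (y : Y) :
  cancel S S' -> orbit_code S S' g (S y) = shift_code 1 (orbit_code S S' g y).
Proof.
move=> SK; rewrite shift_codeE; congr encode_family; apply/funext => n.
by rewrite zpowS.
Qed.

Lemma measurable_zpow d (Y : measurableType d) (S S' : Y -> Y) n :
  measurable_fun setT S -> measurable_fun setT S' ->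
  measurable_fun setT (zpow S S' n).
Proof.
move=> mS mS'.
have mi (f : Y -> Y) k : measurable_fun setT f -> measurable_fun setT (iter k f).
  move=> mf; elim: k => [|k IH]; first exact: measurable_id.
  exact: (measurableT_comp mf IH).
by case: n => k; exact: mi.
Qed.

Lemma measurable_orbit_code d (Y : measurableType d) (S S' : Y -> Y) (g : Y -> R) :
  measurable_fun setT S -> measurable_fun setT S' -> measurable_fun setT g ->
  measurable_fun setT (orbit_code S S' g).
Proof.
move=> mS mS' mg; apply: measurable_encode_family => n.
exact: (measurableT_comp mg (measurable_zpow n mS mS')).
Qed.

End orbit_code.

Local Open Scope ereal_scope.

(** * Image measures, the uniform law and densities *)

Lemma measurable_preimage d d' (O : measurableType d) (U : measurableType d')
    (f : O -> U) (A : set U) :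
  measurable_fun setT f -> measurable A -> measurable (f @^-1` A).
Proof. by move=> mf mA; rewrite -[X in measurable X]setTI; exact: mf. Qed.

Lemma image_probability (R : realType) d d' (O : measurableType d)
    (U : measurableType d') (P : probability O R) (f : O -> U) :
  measurable_fun setT f ->
  exists Q : probability U R, forall A, Q A = P (f @^-1` A).
Proof. by move=> mf; exists (distribution P (mfun_Sub (mem_set mf))). Qed.

Lemma image_restr_measure (R : realType) d d' (O : measurableType d)
    (U : measurableType d') (P : {measure set O -> \bar R}) (f : O -> U) (E : set O) :
  measurable_fun setT f -> measurable E ->
  exists Q : {measure set U -> \bar R}, forall A, Q A = P (f @^-1` A `&` E).
Proof.
move=> mf mE.
by exists (measure_function_pushforward__canonical__measure_function_Measure
  (mrestr P mE) mf).
Qed.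

(** The uniform probability is defined on a copy of the line that carries another
    measurable structure with the same measurable sets; the identity between the
    two copies transports it. *)
Definition of_measurableTypeR (R : realType) : measurableTypeR R -> R := idfun.

Lemma measurable_of_measurableTypeR (R : realType) :
  measurable_fun setT (@of_measurableTypeR R).
Proof. by move=> _ A mA; rewrite setTI. Qed.

Definition unif (R : realType) : probability R R :=
  distribution (uniform_prob (@ltr01 R))
    (mfun_Sub (mem_set (@measurable_of_measurableTypeR R))).

Lemma unif_lt (R : realType) (c : R) : (0 <= c <= 1)%R ->
  unif R [set u | u < c]%R = c%:E.
Proof.
move=> /andP[c0 c1]; rewrite /unif /= /distribution /pushforward /=.
rewrite /uniform_prob integral_uniform_pdf.
rewrite (eq_integral (cst 1)); last first.
  move=> x; rewrite inE => -[_ /=]; rewrite /uniform_pdf in_itv/= => ->.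
  by rewrite subr0 invr1.
rewrite integral_cst//=; last first.
  by apply: measurableI => //; rewrite -set_itvNyo; exact: measurable_itv.
rewrite mul1e.
have [->|c_neq0] := eqVneq c 0%R.
  rewrite (_ : _ `&` _ = set0) ?measure0//.
  by apply/seteqP; split => x //= -[]; rewrite in_itv/= ltNge => /negP h /andP[].
rewrite (_ : _ `&` _ = `[0%R, c[%classic); last first.
  apply/seteqP; split => x /=; rewrite !in_itv/=.
    by move=> [-> /andP[-> _]].
  by move=> /andP[-> xc]; rewrite xc (le_trans (ltW xc)).
by rewrite lebesgue_measure_itv/= lte_fin lt_neqAle eq_sym c_neq0 c0/= oppr0 adde0.
Qed.

Lemma product_measure_fst (R : realType) d d' (Z : measurableType d)
    (U : measurableType d') (rho : probability Z R) (P : probability U R)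
    (A : set (Z * U)) (C : set Z) : measurable A -> measurable C ->
  (rho \x P) (A `&` fst @^-1` C) = \int[rho]_(z in C) P (xsection A z).
Proof.
move=> mA mC; rewrite [RHS]integral_mkcond; apply: eq_integral => z _ /=.
rewrite patchE; case: ifPn => zC.
  congr (P _); apply/seteqP; split => u; rewrite /xsection/= !inE/=; first by case.
  by split=> //; exact: set_mem.
rewrite (_ : xsection _ _ = set0) ?measure0//.
apply/seteqP; split => u; rewrite /xsection/= !inE//= => -[_ /mem_set].
by rewrite (negbTE zC).
Qed.

(** Radon-Nikodym with a density that is real-valued and nonnegative everywhere,
    together with the change of variables it is used for. *)
Lemma dominated_density (R : realType) d (Z : measurableType d)
    (rho : probability Z R) (m : {measure set Z -> \bar R}) :
  (forall C, measurable C -> m C <= rho C) ->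
  exists F : Z -> R, [/\ measurable_fun setT F, forall z, (0 <= F z)%R &
    forall (g : Z -> \bar R) C, measurable C -> measurable_fun C g ->
      (forall z, 0 <= g z) ->
      \int[rho]_(z in C) (g z * (F z)%:E) = \int[m]_(z in C) g z].
Proof.
move=> m_le.
have mT : m setT < +oo.
  apply: (le_lt_trans (m_le _ measurableT)).
  by apply: (le_lt_trans (probability_le1 rho measurableT)); exact: ltry.
pose m' : {finite_measure set Z -> \bar R} := mfrestr measurableT mT.
have m'E C : m' C = m C by rewrite /m' /= /mfrestr /mrestr setIT.
have dom : m' `<< rho.
  apply/null_content_dominatesP => C mC rC; rewrite m'E.
  by apply/eqP; rewrite eq_le measure_ge0 andbT -rC; exact: m_le.
pose f := Radon_Nikodym_SigmaFinite.f m' rho.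
have fE z : (fine (f z))%:E = f z.
  by rewrite fineK//; exact: Radon_Nikodym_SigmaFinite.f_fin_num.
exists (fine \o f); split.
- apply: measurableT_comp; first exact: fine_measurable.
  by have /measurable_int := Radon_Nikodym_SigmaFinite.f_integrable dom.
- by move=> z /=; apply: fine_ge0; exact: Radon_Nikodym_SigmaFinite.f_ge0.
- move=> g C mC mg g0.
  transitivity (\int[rho]_(z in C) (g z * f z)).
    by apply: eq_integral => z _ /=; rewrite fE.
  rewrite Radon_Nikodym_SigmaFinite.change_of_variables//.
  by apply: eq_measure_integral => A mA _; exact: m'E.
Qed.

(** Integrating the positive quantity [F - G] over the set where [G < F] gives at
    most 0, so this set is null. *)
Lemma density_le (R : realType) d (Z : measurableType d)
    (rho : probability Z R) (F G : Z -> R) :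
  measurable_fun setT F -> measurable_fun setT G ->
  (forall z, (0 <= F z)%R) -> (forall z, (0 <= G z)%R) ->
  (forall C, measurable C ->
     \int[rho]_(z in C) (F z)%:E <= \int[rho]_(z in C) (G z)%:E) ->
  (forall C, measurable C -> \int[rho]_(z in C) (G z)%:E < +oo) ->
  rho [set z | G z < F z]%R = 0.
Proof.
move=> mF mG F0 G0 FG Goo.
set B := [set z | _]%R.
have mB : measurable B by exact: measurable_lt_set.
have mE (H : Z -> R) : measurable_fun setT H -> measurable_fun B (EFin \o H).
  by move=> mH; apply/measurable_EFinP; exact: measurable_funTS.
have int0 : \int[rho]_(z in B) (F z - G z)%:E = 0.
  apply/eqP; rewrite eq_le; apply/andP; split; last first.
    by apply: integral_ge0 => z Bz; rewrite lee_fin subr_ge0 ltW.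
  have := FG B mB.
  have -> : \int[rho]_(z in B) (F z)%:E =
      \int[rho]_(z in B) (G z)%:E + \int[rho]_(z in B) (F z - G z)%:E.
    rewrite -ge0_integralD//.
    - by apply: eq_integral => z _; rewrite -EFinD addrC subrK.
    - by move=> z _; rewrite lee_fin.
    - exact: mE.
    - by move=> z Bz; rewrite lee_fin subr_ge0 ltW.
    - by apply: mE; exact: measurable_funB.
  rewrite -leeBrDl; last first.
    by rewrite ge0_fin_numE ?Goo//; apply: integral_ge0 => z _; rewrite lee_fin.
  rewrite subee//.
  by rewrite ge0_fin_numE ?Goo//; apply: integral_ge0 => z _; rewrite lee_fin.
have : ae_eq rho B (fun z => (F z - G z)%:E) (cst 0).
  apply/(ae_eq_integral_abs rho mB); first by apply: mE; exact: measurable_funB.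
  rewrite -int0; apply: eq_integral => z; rewrite inE => Bz.
  by rewrite gee0_abs// lee_fin subr_ge0 ltW.
move=> [N [mN N0 BN]]; apply/eqP; rewrite eq_le measure_ge0 andbT -N0.
apply: le_measure; rewrite ?inE//; apply: subset_trans BN => z Bz /= /(_ Bz)/eqP.
by rewrite eqe subr_eq0 gt_eqF.
Qed.

(** * Noise outsourcing *)

(** The conditional distribution functions [F q] are Radon-Nikodym densities of
    the measures [C |-> la (e < q, C)].  Monotonicity in [q] holds almost
    everywhere for each of the countably many pairs of rationals; on the null
    set where it fails, [F q] is replaced by the indicator of [1 <= q].  Thus
    monotonicity holds at every [z], and [F] can be inverted pointwise. *)
Section conditional_cdf.
Variables (R : realType) (dW dZ : measure_display).
Variables (W : measurableType dW) (Z : measurableType dZ).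
Variables (rho : probability Z R) (la : probability (W * Z)%type R).
Variable e : W -> R.
Hypothesis me : measurable_fun setT e.
Hypothesis e01 : forall w, (0 <= e w < 1)%R.
Hypothesis laZ : forall C, measurable C -> la (snd @^-1` C) = rho C.

Let ray (q : rat) : set (W * Z) := [set p | e p.1 < ratr q]%R.

Let mray q : measurable (ray q).
Proof.
by apply: measurable_lt_set => //; exact: measurableT_comp me measurable_fst.
Qed.

Let msnd C : measurable C -> measurable (snd @^-1` C : set (W * Z)).
Proof. by move=> mC; exact: measurable_preimage. Qed.

Lemma conditional_cdf : exists F : rat -> Z -> R,
  [/\ forall q, measurable_fun setT (F q),
      forall q z, (0 <= F q z <= 1)%R,
      forall z q r, (q <= r)%R -> (F q z <= F r z)%R,
      forall q z, (q <= 0 -> F q z = 0)%R /\ (1 <= q -> F q z = 1)%R &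
      forall q C, measurable C -> \int[rho]_(z in C) (F q z)%:E =
        la (snd @^-1` C `&` ray q)].
Proof.
have /choice[m mE] := fun q => image_restr_measure la (@measurable_snd _ _ W Z) (mray q).
have m_le q C : measurable C -> m q C <= rho C.
  move=> mC; rewrite mE -laZ//; apply: le_measure; rewrite ?inE.
  - by apply: measurableI => //; exact: msnd.
  - exact: msnd.
  - exact: subIsetl.
have /choice[F0 F0P] := fun q => dominated_density (m_le q).
have mF0 q : measurable_fun setT (F0 q) by have [] := F0P q.
have F0_ge0 q z : (0 <= F0 q z)%R by have [] := F0P q.
have F0E q C : measurable C -> \int[rho]_(z in C) (F0 q z)%:E = la (snd @^-1` C `&` ray q).
  move=> mC; have [_ _ /(_ (cst 1) C mC (measurable_cst _) (fun=> lee01))] := F0P q.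
  rewrite integral_cst//= mul1e mE => <-; apply: eq_integral => z _.
  by rewrite mul1e.
(* the values of [e] lie in [0, 1), which forces [F q] for [q] outside ]0, 1[ *)
pose F1 (q : rat) z : R := if (q <= 0)%R then 0%R else if (1 <= q)%R then 1%R else F0 q z.
have mF1 q : measurable_fun setT (F1 q).
  rewrite /F1; case: (q <= 0)%R; first exact: measurable_cst.
  by case: (1 <= q)%R; [exact: measurable_cst|exact: mF0].
have F1_ge0 q z : (0 <= F1 q z)%R by rewrite /F1; case: ifP => // _; case: ifP.
have F1E q C : measurable C -> \int[rho]_(z in C) (F1 q z)%:E = la (snd @^-1` C `&` ray q).
  move=> mC; rewrite /F1; have [q0|q0] := boolP (q <= 0)%R.
    rewrite integral0_eq// (_ : _ `&` _ = set0) ?measure0//.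
    apply/seteqP; split => p //= -[_] /=; rewrite /ray /= => h.
    have /andP[e0 _] := e01 p.1; move: (le_lt_trans e0 h).
    by rewrite ltr0q ltNge q0.
  have [q1|q1] := boolP (1 <= q)%R; last exact: F0E.
  transitivity (rho C); first by rewrite integral_cst// mul1e.
  rewrite -laZ//; congr (la _).
  apply/seteqP; split => p //=; last by case.
  move=> Cp; split=> //; rewrite /ray /=; have /andP[_ e1] := e01 p.1.
  by apply: (lt_le_trans e1); rewrite -(rmorph1 (@ratr R)) ler_rat.
have F1_le (q r : rat) : (q <= r)%R -> rho [set z | F1 r z < F1 q z]%R = 0.
  move=> qr; apply: density_le => // C mC; rewrite !F1E//.
    apply: le_measure; rewrite ?inE.
    - by apply: measurableI => //; exact: msnd.
    - by apply: measurableI => //; exact: msnd.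
    - apply: setIS => p /= h; apply: (lt_le_trans h).
      by rewrite ler_rat.
  apply: (@le_lt_trans _ _ 1); last exact: ltry.
  apply: probability_le1; apply: measurableI => //; exact: msnd.
pose D n := if (unpickle n : option (rat * rat)) is Some (q, r) then
  [set z | (q <= r)%R /\ (F1 r z < F1 q z)%R] else set0.
have mD n : measurable (D n) /\ rho (D n) = 0.
  rewrite /D; case: unpickle => [[q r]|]; last by rewrite measure0.
  have [qr|qr] := pselect (q <= r)%R; last first.
    rewrite (_ : [set z | _] = set0) ?measure0//.
    by apply/seteqP; split => z // [].
  rewrite (_ : [set z | _] = [set z | F1 r z < F1 q z]%R).
    by split; [exact: measurable_lt_set|exact: F1_le].
  by apply/seteqP; split => z // [].
pose bad := \bigcup_n D n.
have mbad : measurable bad by apply: bigcupT_measurable => n; exact: (mD n).1.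
have bad0 : rho bad = 0.
  apply/(negligibleP rho mbad); apply: negligible_bigcup => n.
  by apply/(negligibleP rho (mD n).1); exact: (mD n).2.
pose F (q : rat) z : R := if z \in bad then (if (1 <= q)%R then 1 else 0)%R else F1 q z.
have mF q : measurable_fun setT (F q).
  apply: measurable_fun_ifT => //.
  by apply: (measurable_fun_bool true); rewrite setTI preimage_mem_true.
have ltF z (q r : rat) : (q <= r)%R -> (F q z <= F r z)%R.
  move=> qr; rewrite /F; case: ifPn => [_|/negP zb].
    by case: ifP => [q1|_]; [rewrite (le_trans q1 qr)|case: ifP].
  rewrite leNgt; apply/negP => h; apply: zb; apply/mem_set.
  by exists (pickle (q, r)); [exact: I|rewrite /D pickleK].
have FE (q : rat) z : (q <= 0 -> F q z = 0)%R /\ (1 <= q -> F q z = 1)%R.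
  rewrite /F; split=> q01; last first.
    by rewrite /F1 q01 leNgt (lt_le_trans _ q01) ?ltr01//=; case: ifP.
  by rewrite /F1 q01 leNgt (le_lt_trans q01) ?ltr01//=; case: ifP.
exists F; split=> //.
- move=> q z; apply/andP; split.
    rewrite -((FE (Order.min q 0%R) z).1 _); last by rewrite ge_min lexx orbT.
    by apply: ltF; rewrite ge_min lexx.
  rewrite -[leRHS]((FE (Order.max q 1%R) z).2 _); last by rewrite le_max lexx orbT.
  by apply: ltF; rewrite le_max lexx.
- move=> q C mC; rewrite -F1E//; apply: ae_eq_integral => //.
  + by apply/measurable_EFinP; exact: measurable_funTS.
  + by apply/measurable_EFinP; exact: measurable_funTS.
  + exists bad; split=> // z /= nFz; apply: contrapT => zb; apply: nFz => _.
    by rewrite /F memNset.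
Qed.

End conditional_cdf.

Lemma measure_unique_rays (R : realType) (m1 m2 : {measure set R -> \bar R}) :
  m1 setT < +oo ->
  (forall a : R, m1 [set x | x < a]%R = m2 [set x | x < a]%R) ->
  forall A, measurable A -> m1 A = m2 A.
Proof.
move=> m1oo m12 A mA.
have fin (a : R) : m1 [set x | x < a]%R < +oo.
  apply: le_lt_trans m1oo; apply: le_measure; rewrite ?inE//.
  by rewrite -set_itvNyo; exact: measurable_itv.
refine (@g_sigma_algebra_measure_unique _ R R (@RGenInftyO.G R) _
  (fun n => `]-oo, n%:R[%classic) _ _ m1 m2 _ _ _ A _).
- by move=> _ [x ->]; exact: measurable_itv.
- by move=> n; exists n%:R.
- apply/seteqP; split => // x _; exists (Num.truncn x).+1 => //=.
  by rewrite in_itv/=; exact: truncnS_gt.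
- move=> _ _ [x ->] [y ->]; exists (Order.min x y).
  apply/seteqP; split => t /=; rewrite !in_itv/= lt_min; first by move=> [-> ->].
  by move=> /andP[].
- by move=> _ [x ->]; rewrite set_itvNyo m12.
- by move=> n; rewrite set_itvNyo; exact: fin.
- have MA := congr1 (fun M => M A) (RGenInftyO.measurableE R).
  exact: (eq_ind _ id mA _ MA).
Qed.

Section noise.
Variables (R : realType) (dW dZ : measure_display).
Variables (W : measurableType dW) (Z : measurableType dZ).
Variables (rho : probability Z R) (la : probability (W * Z)%type R).
Hypothesis laZ : forall C, measurable C -> la (snd @^-1` C) = rho C.

(** Inverse transform sampling, fibrewise: [phi (z, u)] is the infimum of the [q]
    with [u < F q z], and for uniform [u] the event [u < F q z] has probability
    [F q z].  The event that [q] is in the cut agrees with [phi < q] only up to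
    the boundary, so the laws are compared on the rays [x < a] by
    approximating [a] from below by rationals. *)
Lemma quantile_sampling (e : W -> R) :
  measurable_fun setT e -> (forall w, 0 <= e w < 1)%R ->
  exists phi : Z * R -> R, measurable_fun setT phi /\
    forall (A : set R) (C : set Z), measurable A -> measurable C ->
      (rho \x unif R) (phi @^-1` A `&` fst @^-1` C) = la ((e \o fst) @^-1` A `&` snd @^-1` C).
Proof.
move=> me e01.
have [F [mF F01 ltF F_01 FE]] := conditional_cdf me e01 laZ.
(* the clauses [0 < q] and [1 <= q] make the cut bounded and nonempty for every
   [u], including those outside of the unit interval *)
pose cut (p : Z * R) : set rat := [set q | 0 < q /\ (1 <= q \/ p.2 < F q p.1)]%R.
pose phi p := real_of_cut R (cut p).
have mcut q : measurable [set p | cut p q].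
  rewrite /cut /=; have [q0|q0] := boolP (0 < q)%R; last first.
    by rewrite (_ : mkset _ = set0)//; apply/seteqP; split => p //= [].
  have [q1|q1] := boolP (1 <= q)%R.
    by rewrite (_ : mkset _ = setT)//; apply/seteqP; split => p //= _; split=> //; left.
  rewrite (_ : mkset _ = [set p | p.2 < F q p.1]%R).
    by apply: measurable_lt_set => //; exact: measurableT_comp (mF q) measurable_fst.
  apply/seteqP; split => p /=; first by move=> [_ []].
  by move=> h; split=> //; right.
have mphi : measurable_fun setT phi by exact: measurable_real_of_cut.
have cut_le p q r : (q <= r)%R -> cut p q -> cut p r.
  move=> qr [q0 h]; split; first exact: lt_le_trans qr.
  case: h => [q1|h]; first by left; exact: le_trans qr.
  by right; apply: (lt_le_trans h); exact: ltF.
have phi_lt p (a : R) : (phi p < a)%R <-> exists2 q, cut p q & (ratr q < a)%R.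
  apply: (real_of_cut_lt (b := 0%R)); first by exists 1%R; split=> //; left.
  by move=> q [q0 _]; rewrite ler0q ltW.
have cutE q C : measurable C ->
    (rho \x unif R) ([set p | cut p q] `&` fst @^-1` C) =
    la ([set p | e p.1 < ratr q]%R `&` snd @^-1` C).
  move=> mC; rewrite product_measure_fst// setIC -FE//.
  apply: eq_integral => z _.
  rewrite (_ : xsection _ _ = [set u | cut (z, u) q]); last first.
    by apply/seteqP; split => u; rewrite /xsection/= inE.
  rewrite /cut /=; have [q0|q0] := ltP 0%R q; last first.
    rewrite (F_01 q z).1// (_ : mkset _ = set0) ?measure0//.
    by apply/seteqP; split => u //= [].
  have [q1|q1] := boolP (1 <= q)%R.
    rewrite (F_01 q z).2// (_ : mkset _ = setT) ?probability_setT//.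
    by apply/seteqP; split => u //= _; split=> //; left.
  rewrite (_ : mkset _ = [set u | u < F q z]%R); first by rewrite unif_lt.
  apply/seteqP; split => u /=; first by move=> [_ []].
  by move=> h; split=> //; right.
exists phi; split=> // A C mA mC.
have mC1 : measurable (fst @^-1` C : set (Z * R)) by exact: measurable_preimage.
have mC2 : measurable (snd @^-1` C : set (W * Z)) by exact: measurable_preimage.
have me1 : measurable_fun setT (e \o fst : W * Z -> R).
  exact: measurableT_comp me measurable_fst.
have [m1 m1E] := image_restr_measure (rho \x unif R) mphi mC1.
have [m2 m2E] := image_restr_measure la me1 mC2.
rewrite -m1E -m2E; move: A mA; apply: measure_unique_rays.
  rewrite m1E preimage_setT setTI; apply: (@le_lt_trans _ _ 1); last exact: ltry.
  exact: probability_le1.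
move=> a; rewrite m1E m2E.
have [r [r_nd r_lt r_cof]] := exists_rat_ladder a.
have r_mono : {homo r : n m / (n <= m)%N >-> (n <= m)%R}.
  by apply/nondecreasing_seqP.
have -> : phi @^-1` [set x | x < a]%R `&` fst @^-1` C =
    \bigcup_n ([set p | cut p (r n)] `&` fst @^-1` C).
  apply/seteqP; split => p /=.
    move=> [/phi_lt[q cq qa] Cp]; have [n qn] := r_cof q qa.
    by exists n => //; split=> //; exact: cut_le cq.
  move=> [n _ [cn Cp]]; split=> //; apply/phi_lt; exists (r n) => //.
have -> : (e \o fst) @^-1` [set x | x < a]%R `&` snd @^-1` C =
    \bigcup_n ([set p | e p.1 < ratr (r n)]%R `&` snd @^-1` C).
  apply/seteqP; split => p /=.
    move=> [ea Cp]; have [q] := rat_in_itvoo ea; rewrite in_itv/= => /andP[eq qa].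
    have [n qn] := r_cof q qa; exists n => //; split=> //=.
    by apply: (lt_le_trans eq); rewrite ler_rat.
  by move=> [n _ [cn Cp]]; split=> //; exact: lt_trans cn (r_lt n).
have mE1 n : measurable ([set p | cut p (r n)] `&` fst @^-1` C) by exact: measurableI.
have mE2 n : measurable ([set p | e p.1 < ratr (r n)]%R `&` snd @^-1` C).
  by apply: measurableI => //; exact: measurable_lt_set.
have cvg1 : (rho \x unif R) ([set p | cut p (r n)] `&` fst @^-1` C) @[n --> \oo]
   --> (rho \x unif R) (\bigcup_n ([set p | cut p (r n)] `&` fst @^-1` C)).
  apply: nondecreasing_cvg_mu => //; first exact: bigcupT_measurable.
  move=> n m nm; apply/subsetPset; apply: setSI => p; apply: cut_le.
  exact: r_mono.
have cvg2 : la ([set p | e p.1 < ratr (r n)]%R `&` snd @^-1` C) @[n --> \oo]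
   --> la (\bigcup_n ([set p | e p.1 < ratr (r n)]%R `&` snd @^-1` C)).
  apply: nondecreasing_cvg_mu => //; first exact: bigcupT_measurable.
  move=> n m nm; apply/subsetPset; apply: setSI => p /= /lt_le_trans; apply.
  by rewrite ler_rat; exact: r_mono.
apply: etrans (esym (cvg_lim _ cvg1)) (etrans _ (cvg_lim _ cvg2)) => //.
congr (limn _).
by apply/funext => n; exact: cutE.
Qed.

(** The transfer theorem: a random element [w] with values in a coded space is, in
    joint law with [z], a function of [z] and an independent uniform variable.
    It takes the place of disintegration. *)
Lemma noise_outsourcing : coded R W ->
  exists phi : Z * R -> W, measurable_fun setT phi /\
    forall (A : set W) (C : set Z), measurable A -> measurable C ->
      (rho \x unif R) (phi @^-1` A `&` fst @^-1` C) = la (fst @^-1` A `&` snd @^-1` C).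
Proof.
move=> [e [r [me mr eK e01]]].
have [phi [mphi phiE]] := quantile_sampling me e01.
exists (r \o phi); split; first exact: measurableT_comp.
move=> A C mA mC.
have mrA : measurable (r @^-1` A) by exact: measurable_preimage.
rewrite (_ : (r \o phi) @^-1` A = phi @^-1` (r @^-1` A))// phiE//.
by congr (la (_ `&` _)); apply/seteqP; split => p /=; rewrite eK.
Qed.

End noise.

(** * Conditional laws given by a randomised map *)

Lemma ge0_integral_image (R : realType) d d' (O : measurableType d)
    (U : measurableType d') (P : {measure set O -> \bar R})
    (Q : {measure set U -> \bar R}) (f : O -> U) (g : U -> \bar R) (C : set U) :
  measurable_fun setT f ->
  (forall A, measurable A -> P (f @^-1` A) = Q A) ->
  measurable C -> measurable_fun C g -> (forall u, C u -> 0 <= g u) ->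
  \int[Q]_(u in C) g u = \int[P]_(w in f @^-1` C) g (f w).
Proof.
move=> mf PQ mC mg g0.
transitivity (\int[pushforward P f]_(u in C) g u); last first.
  by rewrite (ge0_integral_pushforward mf P)// => u; rewrite inE; exact: g0.
by apply: eq_measure_integral => A mA _; apply/esym; exact: PQ.
Qed.

Lemma integrable_unit (R : realType) d (O : measurableType d)
    (P : probability O R) (f : O -> R) :
  measurable_fun setT f -> (forall w, 0 <= f w <= 1)%R ->
  P.-integrable setT (EFin \o f).
Proof.
move=> mf f01; have mEf : measurable_fun setT (EFin \o f) by exact/measurable_EFinP.
apply/integrableP; split=> //.
apply: (@le_lt_trans _ _ (\int[P]_z (cst 1) z)); last first.
  rewrite integral_cst// mul1e.
  exact: (le_lt_trans (probability_le1 P measurableT) (ltry _)).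
apply: ge0_le_integral => //; first exact: measurableT_comp.
by move=> z _ /=; have /andP[f0 f1] := f01 z; rewrite lee_fin ger0_norm.
Qed.

Section cond_law.
Variables (R : realType) (dW dZ : measure_display).
Variables (W : measurableType dW) (Z : measurableType dZ).
Variables (phi : Z * R -> W).
Hypothesis mphi : measurable_fun setT phi.

(** The conditional law given [z] of the outsourced variable [phi (z, u)].  It is
    real-valued because it is going to be averaged and multiplied. *)
Definition cond_law (z : Z) (A : set W) : R :=
  fine (unif R [set u | A (phi (z, u))]).

Let sectE z A : xsection (phi @^-1` A) z = [set u | A (phi (z, u))].
Proof. by apply/seteqP; split => u; rewrite /xsection/= inE. Qed.

Lemma measurable_section z A : measurable A ->
  measurable [set u | A (phi (z, u))].
Proof.
move=> mA; rewrite -sectE; apply: measurable_xsection.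
exact: measurable_preimage.
Qed.

Lemma cond_lawE z A : measurable A ->
  (cond_law z A)%:E = unif R [set u | A (phi (z, u))].
Proof.
by move=> mA; rewrite fineK//; apply: fin_num_measure; exact: measurable_section.
Qed.

Lemma cond_law_itv z A : measurable A -> (0 <= cond_law z A <= 1)%R.
Proof.
move=> mA; rewrite -!lee_fin cond_lawE// measure_ge0/=.
by apply: probability_le1; exact: measurable_section.
Qed.

Lemma measurable_cond_law A : measurable A ->
  measurable_fun setT (fun z => cond_law z A).
Proof.
move=> mA; apply: (measurableT_comp (fine_measurable measurableT)).
apply: (eq_measurable_fun (unif R \o xsection (phi @^-1` A))).
  by move=> z _ /=; rewrite sectE.
by apply: measurable_fun_xsection; exact: measurable_preimage.
Qed.

Lemma integral_cond_law (rho : probability Z R) A C :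
  measurable A -> measurable C ->
  \int[rho]_(z in C) (cond_law z A)%:E =
  (rho \x unif R) (phi @^-1` A `&` fst @^-1` C).
Proof.
move=> mA mC; rewrite product_measure_fst//; last exact: measurable_preimage.
by apply: eq_integral => z _; rewrite cond_lawE// sectE.
Qed.

End cond_law.

(** Both sides integrate to [la A (Q' @^-1` E)] over every measurable [E], by
    invariance of [la] and of [rho].  Here [la] is only a function of a pair of
    sets so that the lemma applies to any description of the joint law on
    rectangles. *)
Lemma cond_law_equivariant (R : realType) dW dZ (W : measurableType dW)
    (Z : measurableType dZ) (rho : probability Z R)
    (la : set W -> set Z -> \bar R) (phi : Z * R -> W) (TW : W -> W) (Q : Z -> Z) :
  measurable_fun setT phi ->
  (forall (A : set W) (C : set Z), measurable A -> measurable C ->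
      (rho \x unif R) (phi @^-1` A `&` fst @^-1` C) = la A C) ->
  measurable_fun setT TW -> automorphism rho Q ->
  (forall A C, measurable A -> measurable C ->
     la (TW @^-1` A) (Q @^-1` C) = la A C) ->
  forall A, measurable A ->
  {ae rho, forall z, cond_law phi z (TW @^-1` A) = cond_law phi (Q z) A}.
Proof.
move=> mphi laE mTW [Q' [QK Q'K mQ mQ' Qrho]] la_inv A mA.
have mTA : measurable (TW @^-1` A) by exact: measurable_preimage.
have mK B : measurable B -> measurable_fun setT (fun z => (cond_law phi z B)%:E).
  by move=> mB; apply/measurable_EFinP; exact: measurable_cond_law.
have : ae_eq rho setT (fun z => (cond_law phi z (TW @^-1` A))%:E)
                      (fun z => (cond_law phi (Q z) A)%:E).
  apply: (integral_ae_eq measurableT).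
  - apply: integrable_unit; first exact: measurable_cond_law.
    by move=> z; exact: cond_law_itv.
  - by apply: (measurableT_comp (mK A mA)).
  - move=> E _ mE; rewrite integral_cond_law// laE//.
    have mQE : measurable (Q' @^-1` E) by exact: measurable_preimage.
    have EQ : E = Q @^-1` (Q' @^-1` E) by apply/seteqP; split => z /=; rewrite QK.
    transitivity (la A (Q' @^-1` E)); first by rewrite {1}EQ; exact: la_inv.
    rewrite -(laE A _ mA mQE) -(integral_cond_law mphi rho mA mQE).
    rewrite (ge0_integral_image mQ Qrho mQE
      (g := fun z => (cond_law phi z A)%:E)); last 2 first.
    + exact: measurable_funTS (mK A mA).
    + by move=> z _; rewrite lee_fin; have /andP[] := cond_law_itv mphi z mA.
    by rewrite -EQ.
by apply: filterS => z /= /(_ I)[].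
Qed.

(** Outsourcing over the one-point space: a pair of independent uniform variables
    is a function of a single uniform variable. *)
Lemma exists_split_uniform (R : realType) : exists theta : R -> R * R,
  measurable_fun setT theta /\
  forall A B, measurable A -> measurable B ->
    unif R (theta @^-1` (A `*` B)) = unif R A * unif R B.
Proof.
pose f (p : R * R) : (R * R) * unit := (p, tt).
have mf : measurable_fun setT f by exact: measurable_fun_pair.
have [la laE] := image_probability (unif R \x unif R) mf.
pose rho : probability unit R := \d_tt.
have la2 C : measurable C -> la (snd @^-1` C) = rho C.
  move=> _; rewrite laE /f /preimage/= /rho/= diracE.
  have [/set_mem Ct|/negP Ct] := boolP (tt \in C).
    rewrite (_ : mkset _ = setT) ?probability_setT//.
    by apply/seteqP; split.
  rewrite (_ : mkset _ = set0) ?measure0//.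
  by apply/seteqP; split => // p /= /mem_set.
have [phi [mphi phiE]] := noise_outsourcing la2 (coded_prod R).
exists (fun u => phi (tt, u)); split.
  by apply: measurableT_comp mphi _; exact: measurable_fun_pair.
move=> A B mA mB; have mAB := measurableX mA mB.
have h := phiE _ setT mAB measurableT.
transitivity (la (fst @^-1` (A `*` B) `&` snd @^-1` setT)); last first.
  rewrite laE -(product_measure1E (unif R) (unif R) mA mB).
  by congr (_ _); apply/seteqP; split => p // [].
rewrite -h product_measure_fst//; last exact: measurable_preimage.
rewrite integral_dirac// diracT mul1e; congr (unif R _).
by apply/seteqP; split => u; rewrite /xsection/= inE.
Qed.

(** Independence and the uniform marginals in one formula: the marginals are the
    case where all the sets but one are the whole line. *)
Definition iid_uniform (R : realType) (V : nat -> R -> R) : Prop :=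
  (forall k, measurable_fun setT (V k)) /\
  forall n (A : nat -> set R), (forall k, measurable (A k)) ->
    unif R [set u | forall k, (k < n)%N -> A k (V k u)] =
    (\prod_(k < n) fine (unif R (A k)))%:E.

(** Split a uniform variable into two, keep the first component, and iterate on
    the second. *)
Lemma exists_iid_uniform (R : realType) : exists V : nat -> R -> R, iid_uniform V.
Proof.
have [theta [mtheta thetaE]] := exists_split_uniform R.
pose V := fix V k : R -> R :=
  if k is j.+1 then V j \o snd \o theta else fst \o theta.
have mV k : measurable_fun setT (V k).
  elim: k => [|k IH]; first exact: measurableT_comp measurable_fst mtheta.
  by apply: (measurableT_comp (f := V k)) => //; exact: measurableT_comp measurable_snd mtheta.
exists V; split=> // n A; elim: n A => [|n IH] A mA.
  rewrite big_ord0 (_ : mkset _ = setT) ?probability_setT//.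
  by apply/seteqP; split => u.
rewrite big_ord_recl EFinM fineK; last exact: fin_num_measure.
rewrite -(IH (fun k => A k.+1))// -thetaE//; last first.
  rewrite (_ : mkset _ = \bigcap_(k in [set k | (k < n)%N]) (V k @^-1` A k.+1)).
    apply: fin_bigcap_measurable => // k _; exact: measurable_preimage.
  by apply/seteqP; split => u.
congr (unif R _); apply/seteqP; split => u /=.
  move=> h; split; first exact: (h 0%N).
  by move=> k kn; exact: (h k.+1).
by move=> [h0 h] [|k] // kn; exact: h.
Qed.

Section iid_uniform.
Variables (R : realType) (V : nat -> R -> R).
Hypothesis iidV : iid_uniform V.

Lemma iid_uniform_law k A : measurable A -> unif R (V k @^-1` A) = unif R A.
Proof.
move=> mA; pose B j := if j == k then A else setT.
have mB j : measurable (B j) by rewrite /B; case: ifP.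
have := iidV.2 k.+1 B mB.
rewrite (_ : mkset _ = V k @^-1` A); last first.
  apply/seteqP; split => u /=; first by move/(_ k (ltnSn k)); rewrite /B eqxx.
  by move=> Au j _; rewrite /B; case: eqP => // ->.
move=> ->; rewrite big_ord_recr /= big1 ?mul1r; last first.
  by move=> j _; rewrite /B ltn_eqF// probability_setT.
by rewrite /B eqxx fineK//; exact: fin_num_measure.
Qed.

Lemma iid_uniform_law2 i j A : i != j -> measurable A ->
  unif R (V i @^-1` A `&` V j @^-1` A) = (fine (unif R A) ^+ 2)%:E.
Proof.
wlog ij : i j / (i < j)%N => [hw ij_neq mA|_ mA].
  have [ij|ji|ijE] := ltngtP i j; first exact: hw.
    by rewrite setIC; apply: hw => //; rewrite eq_sym.
  by rewrite ijE eqxx in ij_neq.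
pose B l := if (l == i) || (l == j) then A else setT.
have mB l : measurable (B l) by rewrite /B; case: ifP.
have := iidV.2 j.+1 B mB.
rewrite (_ : mkset _ = V i @^-1` A `&` V j @^-1` A); last first.
  apply/seteqP; split => u /=.
    move=> h; split; first by have := h i (leqW ij); rewrite /B eqxx.
    by have := h j (ltnSn j); rewrite /B eqxx orbT.
  by move=> [Ai Aj] l _; rewrite /B; case: eqP => [->|_] //=; case: eqP => // ->.
move=> ->; rewrite big_ord_recr /= (bigD1 (Ordinal ij))//= big1; last first.
  move=> l li; have /negbTE lni : l != i :> nat by [].
  by rewrite /B lni (ltn_eqF (ltn_ord l)) probability_setT.
by rewrite /B !eqxx orbT mulr1 -expr2.
Qed.

End iid_uniform.

(** * Conditionally independent samples *)

(** Samplers [psi k] with values in powers of [X] are run on the same [y] with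
    independent noises [V k], and their outputs are concatenated into one point
    of the power indexed by all pairs of a sampler and one of its coordinates. *)
Section combine.
Variables (R : realType) (dX dY : measure_display).
Variables (X : measurableType dX) (Y : measurableType dY).
Variables (I_ : nat -> countType).

Notation PX := (power_space {k : nat & I_ k} X).

Definition block (k : nat) (x : PX) : power_space (I_ k) X :=
  fun i => x (Tagged I_ i).

Arguments block k x : clear implicits.

Lemma measurable_block k : measurable_fun setT (block k).
Proof. by apply: measurable_fun_power => i; exact: measurable_coord. Qed.

(** Rectangles with respect to finitely many blocks.  They are stable under
    intersection and generate the product sigma-algebra, and conditional
    independence computes their measure, so that they serve as the pi-system on
    which laws are compared. *)
Definition box (n : nat) (A : forall k, set (power_space (I_ k) X)) (B : set Y) :
    set (PX * Y) :=
  [set p | (forall k, (k < n)%N -> A k (block k p.1)) /\ B p.2].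

Definition boxes : set (set (PX * Y)) :=
  [set C | exists n A B, [/\ forall k, measurable (A k), measurable B & C = box n A B]].

Lemma measurable_box n A B : (forall k, measurable (A k)) -> measurable B ->
  measurable (box n A B).
Proof.
move=> mA mB.
rewrite (_ : box n A B = (\bigcap_(k in [set k | (k < n)%N]) ((block k \o fst) @^-1` A k))
   `&` snd @^-1` B).
  apply: measurableI; last exact: measurable_preimage.
  apply: fin_bigcap_measurable => // k _; apply: measurable_preimage => //.
  apply: (measurableT_comp (@measurable_block k)); exact: measurable_fst.
by apply/seteqP; split => p.
Qed.

Lemma measurable_boxes : @measurable _ (PX * Y)%type `<=` <<s boxes >>.
Proof.
pose O : measurableType _ := g_sigma_algebraType boxes.
suff : measurable_fun setT (idfun : O -> PX * Y)%type.
  by move=> mid A mA; have := mid measurableT A mA; rewrite setTI.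
have box_mem n A B : (forall k, measurable (A k)) -> measurable B ->
    @measurable _ O (box n A B).
  by move=> mA mB; apply: sub_sigma_algebra; exists n, A, B.
apply/measurable_fun_pairP; split.
  apply: measurable_fun_power => -[k i] _ A mA; rewrite setTI.
  (* a dependent family of sets equal to the cylinder over [i] at [k] and to the
     whole space elsewhere *)
  pose Ak j : set (power_space (I_ j) X) :=
    [set x | forall e : k = j, A (x (eq_rect k I_ i j e))].
  have AkE : Ak k = (fun x => x i) @^-1` A.
    apply/seteqP; split => x /=; first by move/(_ erefl).
    by move=> xA e; rewrite (eq_axiomK e).
  have mAk j : measurable (Ak j).
    have [kj|kj] := pselect (k = j); last first.
      by rewrite (_ : Ak j = setT)//; apply/seteqP; split => x // _ e.
    by subst j; rewrite AkE; exact: measurable_cylinder.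
  have := box_mem k.+1 Ak setT mAk measurableT.
  congr measurable; apply/seteqP; split => p /=.
    by move=> [/(_ k (ltnSn k)) + _]; rewrite AkE.
  by move=> pA; split => // j _ e; subst j.
move=> _ B mB; rewrite setTI.
have := @box_mem 0%N (fun=> setT) B (fun=> measurableT) mB.
by congr measurable; apply/seteqP; split => p //= [].
Qed.

Lemma probability_unique_boxes (P Q : probability (PX * Y)%type R) :
  (forall n A B, (forall k, measurable (A k)) -> measurable B ->
     P (box n A B) = Q (box n A B)) ->
  forall C, measurable C -> P C = Q C.
Proof.
move=> PQ C /measurable_boxes; apply: (@g_sigma_algebra_measure_unique _ R _ boxes _
  (fun=> setT)) => //.
- by move=> _ [n [A [B [mA mB ->]]]]; exact: measurable_box.
- move=> _; exists 0%N, (fun=> setT), setT; split=> //.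
  by apply/seteqP; split => p.
- by apply/seteqP; split => // p _; exists 0%N.
- move=> _ _ [n [A [B [mA mB ->]]]] [n' [A' [B' [mA' mB' ->]]]].
  pose upto n (A : forall k, set (power_space (I_ k) X)) k : set (power_space (I_ k) X) :=
    if (k < n)%N then A k else setT.
  exists (maxn n n'), (fun k => upto n A k `&` upto n' A' k), (B `&` B'); split.
  + move=> k; apply: measurableI; rewrite /upto; case: ifP => // _; exact: mA.
  + exact: measurableI.
  apply/seteqP; split => p /=.
    move=> [[An Bp] [An' Bp']]; split=> // k _; rewrite /upto; split.
      by case: ifP => // /An.
    by case: ifP => // /An'.
  move=> [h [Bp Bp']]; split; split=> // k kn.
    by have [] := h k (leq_trans kn (leq_maxl _ _)); rewrite /upto kn.
  by have [_] := h k (leq_trans kn (leq_maxr _ _)); rewrite /upto kn.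
- by move=> A [n [A1 [B [mA mB ->]]]]; exact: PQ.
- by move=> _; apply: (le_lt_trans (probability_le1 P measurableT) (ltry _)).
Qed.

Variables (nu : probability Y R) (V : nat -> R -> R).
Hypothesis iidV : iid_uniform V.
Variable psi : forall k, Y * R -> power_space (I_ k) X.
Arguments psi : clear implicits.
Hypothesis mpsi : forall k, measurable_fun setT (psi k).

Definition joined (p : Y * R) : PX * Y :=
  (fun ki => psi (tag ki) (p.1, V (tag ki) p.2) (tagged ki), p.1).

Let mpsiV k : measurable_fun setT (fun p : Y * R => psi k (p.1, V k p.2)).
Proof.
apply: measurableT_comp => //; apply: measurable_fun_pair => //.
by apply: (measurableT_comp (iidV.1 k)).
Qed.

Lemma measurable_joined : measurable_fun setT joined.
Proof.
apply: measurable_fun_pair => //.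
apply: measurable_fun_power => -[k i] /=.
exact: (measurableT_comp (measurable_coord i) (@mpsiV k)).
Qed.

(** Given [y], the blocks are independent and the k-th one has law
    [cond_law (psi k) y]. *)
Lemma joined_box n A B : (forall k, measurable (A k)) -> measurable B ->
  (nu \x unif R) (joined @^-1` box n A B) =
  \int[nu]_(y in B) (\prod_(k < n) cond_law (psi k) y (A k))%:E.
Proof.
move=> mA mB.
pose D : set (Y * R) := [set p | forall k, (k < n)%N -> A k (psi k (p.1, V k p.2))].
have mD : measurable D.
  rewrite (_ : D = \bigcap_(k in [set k | (k < n)%N])
     ((fun p : Y * R => psi k (p.1, V k p.2)) @^-1` A k)).
    by apply: fin_bigcap_measurable => // k _; exact: measurable_preimage.
  by apply/seteqP; split => p.
rewrite (_ : joined @^-1` _ = D `&` fst @^-1` B); last by apply/seteqP; split => p.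
rewrite product_measure_fst//; apply: eq_integral => y _.
rewrite (_ : xsection D y = [set u | forall k, (k < n)%N -> [set v | A k (psi k (y, v))] (V k u)]).
  rewrite (iidV.2 n (fun k => [set v | A k (psi k (y, v))]))// => k.
  exact: (measurable_section (@mpsi k) y (mA k)).
by apply/seteqP; split => u; rewrite /xsection/= inE.
Qed.

(** On boxes the measure is the integral of a product of conditional laws;
    equivariance of each factor replaces [y] by [S y] in the integrand, and [S]
    preserves [nu]. *)
Lemma joined_invariant (T : X -> X) (S : Y -> Y) :
  measurable_fun setT T -> automorphism nu S ->
  (forall k (A : set (power_space (I_ k) X)), measurable A ->
     {ae nu, forall y, cond_law (psi k) y (@power_map (I_ k) X T @^-1` A) =
                       cond_law (psi k) (S y) A}) ->
  forall C : set (PX * Y), measurable C ->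
  (nu \x unif R) (joined @^-1` ((fun q : PX * Y => (@power_map _ X T q.1, S q.2)) @^-1` C)) =
  (nu \x unif R) (joined @^-1` C).
Proof.
move=> mT [S' [SK S'K mS mS' Snu]] equi.
pose TS (q : PX * Y) : PX * Y := (@power_map _ X T q.1, S q.2).
have mTS : measurable_fun setT TS.
  apply: measurable_fun_pair.
    exact: (measurableT_comp (measurable_power_map mT) measurable_fst).
  exact: (measurableT_comp mS measurable_snd).
have [P PE] := image_probability (nu \x unif R) measurable_joined.
have [Q QE] := image_probability P mTS.
move=> C mC; apply: etrans (esym (etrans (QE _) (PE _))) (etrans _ (PE _)).
apply: probability_unique_boxes mC => n A B mA mB.
apply: etrans (etrans (QE _) (PE _)) (etrans _ (esym (PE _))).
pose A' k : set (power_space (I_ k) X) := @power_map (I_ k) X T @^-1` A k.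
have mA' k : measurable (A' k).
  exact: (measurable_preimage (measurable_power_map mT) (mA k)).
rewrite (_ : TS @^-1` box n A B = box n A' (S @^-1` B)); last exact: erefl.
have mSB : measurable (S @^-1` B) by exact: measurable_preimage.
apply: etrans (joined_box _ mA' mSB) (etrans _ (esym (joined_box _ mA mB))).
have mK k D : measurable D -> measurable_fun setT (fun y => cond_law (psi k) y D).
  by move=> mD; exact: measurable_cond_law.
have mprod (E : forall k, set (power_space (I_ k) X)) : (forall k, measurable (E k)) ->
    measurable_fun setT (fun y => (\prod_(k < n) cond_law (psi k) y (E k))%:E).
  by move=> mE; apply/measurable_EFinP; apply: measurable_prod => k _; exact: mK.
have prod0 (E : forall k, set (power_space (I_ k) X)) y : (forall k, measurable (E k)) ->
    0 <= (\prod_(k < n) cond_law (psi k) y (E k))%:E.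
  move=> mE; rewrite lee_fin; apply: prodr_ge0 => k _.
  by have /andP[] := cond_law_itv (@mpsi k) y (mE k).
transitivity (\int[nu]_(y in S @^-1` B) (\prod_(k < n) cond_law (psi k) (S y) (A k))%:E).
  apply: ge0_ae_eq_integral.
  - exact: measurable_preimage.
  - exact: measurable_funTS (mprod A' mA').
  - by apply: measurable_funTS; exact: (measurableT_comp (mprod A mA)).
  - by move=> y _; exact: prod0.
  - by move=> y _; exact: prod0.
  have /ae_foralln := fun k => equi k (A k) (mA k).
  by apply: filterS => y h _; congr (_%:E); apply: eq_bigr => k _; exact: h.
apply/esym; apply: (ge0_integral_image mS Snu mB (g := fun y =>
  (\prod_(k < n) cond_law (psi k) y (A k))%:E)) => [|y _]; last exact: prod0.
exact: measurable_funTS (mprod A mA).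
Qed.

(** Each noise [V k] is uniform and independent of [y], so that a single sample
    still has the joint law with [y] that it was built for. *)
Lemma joined_sample_law k (D : set (Y * R)) : measurable D ->
  (nu \x unif R) [set p | D (p.1, V k p.2)] = (nu \x unif R) D.
Proof.
move=> mD.
apply: eq_integral => y _ /=.
rewrite -[RHS](iid_uniform_law iidV k); last exact: measurable_xsection.
by congr (unif R _); apply/seteqP; split => u; rewrite /xsection/= !inE.
Qed.

End combine.
Arguments block {dX X I_} k x.

(** * T-factors obtained by sampling *)

Lemma measure_eq_outside (R : realType) d (O : measurableType d)
    (P : {measure set O -> \bar R}) (N A B : set O) :
  measurable N -> P N = 0%E -> measurable A -> measurable B ->
  (forall w, ~ N w -> (A w <-> B w)) -> P A = P B.
Proof.
move=> mN N0 mA mB AB.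
have split C : measurable C -> P C = P (C `\` N).
  move=> mC; rewrite -{1}(setUIDK C N) measureU//.
  - rewrite -[RHS]add0e; congr (_ + _)%E; apply/eqP.
    rewrite eq_le measure_ge0 andbT -N0; apply: le_measure; rewrite ?inE//.
    exact: measurableI.
  - exact: measurableI.
  - exact: measurableD.
  - by apply/seteqP; split => x // [[_ Nx] [_ /(_ Nx)]].
rewrite (split A)// (split B)//; congr (P _).
by apply/seteqP; split => w [h nN]; split=> //; apply/(AB w nN).
Qed.

(** A variable seen from both sides generates a T-factor: if [a] on a joining of
    copies of [T] and [g] on [Y] agree almost surely under an invariant
    coupling, then so do their values along the whole orbits, and the orbit
    process of [g] is a factor of [S] with the same law as the orbit process of
    [a], which is a factor of the joining.  The coupling is given by variables
    [Phi] and [eta] on an auxiliary probability space on which no dynamics is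
    assumed. *)
Section coupling.
Variables (R : realType) (dX dY dO : measure_display).
Variables (X : measurableType dX) (Y : measurableType dY) (O : measurableType dO).
Variables (mu : probability X R) (T : X -> X) (nu : probability Y R) (S : Y -> Y).
Hypothesis aT : automorphism mu T.
Hypothesis aS : automorphism nu S.
Variables (P : probability O R) (I : countType).
Notation PX := (power_space I X).
Variables (Phi : O -> PX) (eta : O -> Y).
Hypothesis mPhi : measurable_fun setT Phi.
Hypothesis meta : measurable_fun setT eta.
Hypothesis PhiP : forall i (A : set X), measurable A -> P [set w | A (Phi w i)] = mu A.
Hypothesis etaP : forall B, measurable B -> P (eta @^-1` B) = nu B.
Hypothesis invP : forall C : set (PX * Y), measurable C ->
  P [set w | C (@power_map I X T (Phi w), S (eta w))] = P [set w | C (Phi w, eta w)].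
Variables (g : Y -> R) (a : PX -> R).
Hypothesis mg : measurable_fun setT g.
Hypothesis ma : measurable_fun setT a.
Hypothesis ag : P [set w | a (Phi w) != g (eta w)] = 0%E.

Lemma T_factor_of_coupling : exists F : set (set Y),
  T_factor_sigma_algebra mu T nu S F /\
  forall A, measurable A -> F (g @^-1` A).
Proof.
have [T' [TK T'K mT mT' Tmu]] := aT.
have [S' [SK S'K mS mS' Snu]] := aS.
pose T1 : PX -> PX := @power_map I X T.
pose T1' : PX -> PX := @power_map I X T'.
have mT1 : measurable_fun setT T1 by exact: measurable_power_map.
have mT1' : measurable_fun setT T1' by exact: measurable_power_map.
have T1K : cancel T1 T1' by move=> x; apply/funext => i; exact: TK.
have T1'K : cancel T1' T1 by move=> x; apply/funext => i; exact: T'K.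
pose pi := orbit_code S S' g; pose q : PX -> R := orbit_code T1 T1' a.
have mpi : measurable_fun setT pi by exact: measurable_orbit_code.
have mq : measurable_fun setT q by exact: measurable_orbit_code.
have [rho rhoE] := image_probability nu mpi.
have [m mE] := image_probability P mPhi.
have mj : measurable_fun setT (fun w => (Phi w, eta w) : PX * Y).
  exact: measurable_fun_pair.
have [La LaE] := image_probability P mj.
pose TS (p : PX * Y) : PX * Y := (T1 p.1, S p.2).
pose TS' (p : PX * Y) : PX * Y := (T1' p.1, S' p.2).
have mTS : measurable_fun setT TS.
  apply: measurable_fun_pair; first exact: (measurableT_comp mT1 measurable_fst).
  exact: (measurableT_comp mS measurable_snd).
have mTS' : measurable_fun setT TS'.
  apply: measurable_fun_pair; first exact: (measurableT_comp mT1' measurable_fst).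
  exact: (measurableT_comp mS' measurable_snd).
have LaTS C : measurable C -> La (TS @^-1` C) = La C.
  by move=> mC; rewrite !LaE; exact: invP.
have LaTS' C : measurable C -> La (TS' @^-1` C) = La C.
  move=> mC; rewrite -(LaTS (TS' @^-1` C)); last exact: measurable_preimage.
  by congr (La _); apply/seteqP; split => -[x y]; rewrite /TS/TS'/= T1K SK.
(* disagreement at time 0; by invariance it is null at every integer time *)
pose D : set (PX * Y) := [set p | a p.1 != g p.2].
have ma1 : measurable_fun setT (fun p : PX * Y => a p.1).
  exact: (measurableT_comp ma measurable_fst).
have mg2 : measurable_fun setT (fun p : PX * Y => g p.2).
  exact: (measurableT_comp mg measurable_snd).
have mD : measurable D by exact: measurable_neq_set.
have mz n : measurable_fun setT (zpow TS TS' n) by exact: measurable_zpow.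
have La_iter (f : PX * Y -> PX * Y) k : measurable_fun setT f ->
    (forall C, measurable C -> La (f @^-1` C) = La C) -> La (iter k f @^-1` D) = 0%E.
  move=> mf fLa; elim: k => [|k IH]; first by rewrite LaE.
  rewrite -[RHS]IH -[RHS]fLa; last first.
    apply: measurable_preimage => //; elim: (k) => [|j mj']; first exact: measurable_id.
    exact: (measurableT_comp mf mj').
  by congr (La _); apply/seteqP; split => p; rewrite /preimage/= -iterS iterSr.
have La_null n : La (zpow TS TS' n @^-1` D) = 0%E by case: n => k; exact: La_iter.
have zTS n x y : zpow TS TS' n (x, y) = (zpow T1 T1' n x, zpow S S' n y).
  have h (f : PX -> PX) (f' : Y -> Y) k : iter k (fun p => (f p.1, f' p.2)) (x, y) =
      (iter k f x, iter k f' y) by elim: k => //= k ->.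
  by case: n => k; exact: h.
pose N : set (PX * Y) := \bigcup_k (if (unpickle k : option int) is Some n
   then zpow TS TS' n @^-1` D else set0).
have mN : measurable N.
  apply: bigcupT_measurable => k; case: unpickle => // n.
  exact: measurable_preimage.
have N0 : La N = 0%E.
  apply/(negligibleP La mN); apply: negligible_bigcup => k.
  case: unpickle => [n|]; last exact: negligible_set0.
  by apply/(negligibleP La (measurable_preimage (mz n) mD)); exact: La_null.
have qpi x y : ~ N (x, y) -> q x = pi y.
  move=> nN; congr encode_family; apply/funext => n.
  apply/eqP; rewrite -[_ == _]negbK; apply/negP => h; apply: nN.
  by exists (pickle n); [by []|rewrite pickleK /= zTS].
have mq1 C : measurable C -> m (q @^-1` C) = rho C.
  move=> mC; rewrite mE rhoE -etaP; last exact: measurable_preimage.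
  transitivity (La [set p | C (q p.1)]); first by rewrite LaE.
  transitivity (La [set p | C (pi p.2)]); last by rewrite LaE.
  apply: (measure_eq_outside mN N0).
  - exact: (measurable_preimage (measurableT_comp mq measurable_fst) mC).
  - exact: (measurable_preimage (measurableT_comp mpi measurable_snd) mC).
  - by move=> [x y] /qpi /= ->.
have pi_eq y : pi (S y) = shift_code 1 (pi y) by exact: orbit_code_equivariant.
exists (preimage_set_system setT pi measurable); split; last first.
  (* [g] is the coordinate at time 0 of its orbit process *)
  move=> A mA; exists ((fun t => decode_family t (0 : int)) @^-1` A).
    apply: measurable_preimage => //; exact: measurable_decode_family.
  rewrite setTI; apply/seteqP; split => y /=; by rewrite /pi /orbit_code encode_familyK.
exists default_measure_display, R, rho, (shift_code 1), pi; split.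
- split; first exact: standard_borel_R.
  exists (shift_code (- 1)); split.
  + exact: shift_codeK.
  + by move=> t; rewrite -{1}(opprK 1%R) shift_codeK.
  + exact: measurable_shift_code.
  + exact: measurable_shift_code.
  move=> A mA; rewrite !rhoE -[RHS]Snu; last exact: measurable_preimage.
  by congr (nu _); apply/seteqP; split => y /=; rewrite pi_eq.
- split; first by exists pi; split=> // C mC; rewrite rhoE.
  exists I, m, q; split; split => //.
  + by move=> i A mA; rewrite mE -(PhiP i).
  + move=> C mC; rewrite !mE.
    have := invP (C := fst @^-1` C); apply.
    exact: measurable_preimage.
  + by move=> x; exact: orbit_code_equivariant.
- by split=> // C mC; rewrite rhoE.
- by [].
Qed.

End coupling.

Lemma product_measure_fst_law (R : realType) d d' (Z : measurableType d)
    (U : measurableType d') (rho : probability Z R) (P : probability U R)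
    (C : set Z) : measurable C -> (rho \x P) (fst @^-1` C) = rho C.
Proof.
move=> mC; rewrite (_ : fst @^-1` C = C `*` setT); last first.
  by apply/seteqP; split => p //= [].
rewrite product_measure1E//.
by apply: etrans (congr1 _ (probability_setT P)) (mule1 _).
Qed.

Lemma product_measure_map_fst (R : realType) d d1 d2 (Y : measurableType d1)
    (Z : measurableType d2) (U : measurableType d) (nu : probability Y R)
    (rho : probability Z R) (P : probability U R) (pi : Y -> Z) (D : set (Z * U)) :
  measurable_fun setT pi -> (forall C, measurable C -> nu (pi @^-1` C) = rho C) ->
  measurable D ->
  (nu \x P) [set p | D (pi p.1, p.2)] = (rho \x P) D.
Proof.
move=> mpi piE mD; rewrite /product_measure1.
rewrite (ge0_integral_image mpi piE)//; last exact: (measurable_fun_xsection P mD).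
Qed.

Section sampler.
Variables (R : realType) (dX dY : measure_display).
Variables (X : measurableType dX) (Y : measurableType dY).
Variables (mu : probability X R) (T : X -> X) (nu : probability Y R) (S : Y -> Y).

(** A randomised map from [Y] to a power of [X] such that every coordinate has law
    [mu] and such that the conditional laws intertwine [S] and [T].  These are
    the disintegrations over [nu] of the joinings of [S] with copies of [T], in
    a form that can be run repeatedly with fresh noise. *)
Definition sampler (I : countType) (psi : Y * R -> power_space I X) : Prop :=
  [/\ measurable_fun setT psi,
      forall i (A : set X), measurable A ->
        (nu \x unif R) [set p | A (psi p i)] = mu A &
      forall A : set (power_space I X), measurable A ->
        {ae nu, forall y, cond_law psi y (@power_map I X T @^-1` A) =
                          cond_law psi (S y) A}].

Hypothesis aT : automorphism mu T.
Hypothesis aS : automorphism nu S.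

(** Countably many samplers, run conditionally independently, yield one invariant
    coupling of [S] with copies of [T]. *)
Lemma T_factor_of_samplers (I_ : nat -> countType) (V : nat -> R -> R)
    (psi : forall k, Y * R -> power_space (I_ k) X)
    (g : Y -> R) (a : power_space {k : nat & I_ k} X -> R) :
  iid_uniform V ->
  (forall k, sampler (@psi k)) ->
  measurable_fun setT g -> measurable_fun setT a ->
  (nu \x unif R) [set p | a (joined V psi p).1 != g p.1] = 0 ->
  exists F : set (set Y), T_factor_sigma_algebra mu T nu S F /\
    forall A, measurable A -> F (g @^-1` A).
Proof.
move=> iidV psiP mg ma ag.
have mpsi k : measurable_fun setT (@psi k) by have [] := psiP k.
have equi k := let: And3 _ _ h := psiP k in h.
have mT : measurable_fun setT T by have [T' []] := aT.
have mj := measurable_joined iidV mpsi.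
apply: (@T_factor_of_coupling R dX dY _ X Y (Y * R)%type mu T nu S aT aS
  (nu \x unif R) _ (fun p => (joined V psi p).1) fst _ _ _ _ _ g a _ _ ag).
- exact: (measurableT_comp measurable_fst mj).
- exact: measurable_fst.
- move=> [k i] A mA.
  have [mp marg _] := psiP k; rewrite -(marg i A mA).
  have mD := measurable_preimage (measurableT_comp (measurable_coord i) mp) mA.
  exact: (joined_sample_law nu iidV k mD).
- move=> B mB; exact: product_measure_fst_law.
- move=> C mC; exact: (joined_invariant iidV mpsi mT aS equi mC).
- exact: mg.
- exact: ma.
Qed.

(** A joining of copies of [T] with a factor [Z] of [S] is outsourced over [Z] and
    then driven by the image [pi y] of [y]: this is the relatively independent
    joining of the two systems over [Z]. *)
Lemma noise_sampler (I : countType) dZ (Z : measurableType dZ)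
    (rho : probability Z R) (Q : Z -> Z) (pi : Y -> Z)
    (la : probability (power_space I X * Z)%type R) :
  coded R X -> automorphism rho Q -> factor_map nu S rho Q pi ->
  (forall i A, measurable A -> la [set p | A (p.1 i)] = mu A) ->
  (forall C, measurable C -> la (snd @^-1` C) = rho C) ->
  (forall D : set (power_space I X * Z), measurable D ->
     la [set p | D (@power_map I X T p.1, Q p.2)] = la D) ->
  exists psi : Y * R -> power_space I X, sampler psi /\
    forall A C, measurable A -> measurable C ->
      (nu \x unif R) [set p | A (psi p) /\ C (pi p.1)] = la [set p | A p.1 /\ C p.2].
Proof.
move=> cX aQ [mpi piE piS] la1 la2 laTQ.
have mT : measurable_fun setT T by have [T' []] := aT.
have [phi [mphi phiE]] := noise_outsourcing la2 (coded_power I cX).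
pose psi (p : Y * R) := phi (pi p.1, p.2).
have mpsi : measurable_fun setT psi.
  apply: measurableT_comp => //; apply: measurable_fun_pair => //.
  exact: measurableT_comp.
have psiE A C : measurable A -> measurable C ->
    (nu \x unif R) [set p | A (psi p) /\ C (pi p.1)] = la [set p | A p.1 /\ C p.2].
  move=> mA mC; rewrite -(phiE A C mA mC).
  have mD : measurable (phi @^-1` A `&` fst @^-1` C).
    by apply: measurableI; exact: measurable_preimage.
  by rewrite -(product_measure_map_fst (unif R) mpi piE mD).
exists psi; split=> //; split=> //.
- move=> i A mA; rewrite -(la1 i A mA).
  have := psiE ((fun x : power_space I X => x i) @^-1` A) setT
    (measurable_cylinder i mA) measurableT.
  rewrite (_ : [set p | _] = [set p | A (psi p i)]); last first.
    by apply/seteqP; split => p //= [].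
  move=> ->; congr (la _); by apply/seteqP; split => p //= [].
- move=> A mA.
  have la_inv (B : set (power_space I X)) (C : set Z) : measurable B -> measurable C ->
     la (fst @^-1` ((@power_map I X T : power_space I X -> power_space I X) @^-1` B)
       `&` snd @^-1` (Q @^-1` C)) =
     la (fst @^-1` B `&` snd @^-1` C).
    move=> mB mC; apply: laTQ.
    by apply: measurableI; exact: measurable_preimage.
  have [N [mN N0 NE]] := cond_law_equivariant (la := fun A C => la (fst @^-1` A `&` snd @^-1` C))
     mphi phiE (measurable_power_map mT) aQ la_inv mA.
  exists (pi @^-1` N); split; first exact: measurable_preimage.
    by rewrite piE.
  move=> y /= h; apply: NE => /=; apply: contra_not h.
  by rewrite /cond_law /psi/= piS.
Qed.

End sampler.

(** * A law of large numbers along a subsequence *)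

(** Chebyshev and Borel-Cantelli.  The frequency over the first [8 ^ j] events
    deviates from [p] by [2 ^- j] with probability at most
    [p / (8 ^ j * 4 ^- j) = p * 2 ^- j], which is summable; convergence along
    this subsequence is enough to recover [p] from the sequence of outcomes. *)
Section law_of_large_numbers.
Variables (R : realType) (d : measure_display) (O : measurableType d).
Variables (P : probability O R) (E : nat -> set O) (p : R).
Hypothesis mE : forall k, measurable (E k).
Hypothesis PE : forall k, P (E k) = p%:E.
Hypothesis PEE : forall i j, i != j -> P (E i `&` E j) = (p ^+ 2)%:E.

Let S n w : R := (\sum_(k < n) \1_(E k) w)%R.

Let mS n : measurable_fun setT (S n).
Proof. by apply: measurable_sum => k; exact: measurable_indic. Qed.

Let S0 n w : (0 <= S n w)%R. Proof. by apply: sumr_ge0 => k _; rewrite indicE. Qed.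

Let p0 : (0 <= p)%R. Proof. by rewrite -lee_fin -(PE 0). Qed.

Let intS n : \int[P]_w (S n w)%:E = (n%:R * p)%:E.
Proof.
under eq_integral do rewrite /S -sumEFin.
rewrite ge0_integral_sum//; last first.
  by move=> k; apply/measurable_EFinP; exact: measurable_indic.
rewrite (eq_bigr (fun=> p%:E)); last first.
  by move=> k _; rewrite integral_indic// setIT; exact: PE.
by rewrite sumEFin big_const_ord iter_addr addr0 mulr_natl.
Qed.

Let intS2 n : \int[P]_w (S n w ^+ 2)%:E <= (n%:R * p + (n%:R * p) ^+ 2)%:E.
Proof.
have S2E w : (S n w ^+ 2)%:E =
    \sum_(i < n) \sum_(j < n) (\1_(E i `&` E j) w : R)%:E.
  under eq_bigr do rewrite sumEFin; rewrite sumEFin; congr EFin.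
  rewrite expr2 /S mulr_suml; apply: eq_bigr => i _; rewrite mulr_sumr.
  by apply: eq_bigr => j _; rewrite indicI.
under eq_integral do rewrite S2E.
have mEE i j : measurable_fun setT (fun w => (\1_(E i `&` E j) w : R)%:E).
  by apply/measurable_EFinP; apply: measurable_indic; exact: measurableI.
rewrite ge0_integral_sum//; last 2 first.
- by move=> i; apply: emeasurable_sum.
- by move=> i w _; apply: sume_ge0.
apply: (@le_trans _ _ (\sum_(i < n) \sum_(j < n) ((i == j)%:R * p + p ^+ 2)%:E)).
  apply: lee_sum => i _; rewrite ge0_integral_sum//.
  apply: lee_sum => j _; rewrite integral_indic//; last exact: measurableI.
  rewrite setIT; case: (eqVneq i j) => [->|ij].
    rewrite setIid mul1r; apply: (@le_trans _ _ p%:E).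
      by rewrite le_eqVlt; apply/orP; left; apply/eqP; exact: PE.
    by rewrite lee_fin lerDl sqr_ge0.
  by rewrite mul0r add0r le_eqVlt; apply/orP; left; apply/eqP; exact: PEE.
rewrite le_eqVlt; apply/orP; left; apply/eqP.
under eq_bigr do rewrite sumEFin; rewrite sumEFin; congr EFin.
under eq_bigr => i _.
  rewrite big_split/= (bigD1 i)//= eqxx mul1r big1 ?addr0; last first.
    by move=> j /negbTE ji; rewrite eq_sym ji mul0r.
  rewrite big_const_ord iter_addr addr0.
  over.
rewrite big_const_ord iter_addr addr0 mulrnDl -mulrnA.
by rewrite -(mulr_natl p n) -(mulr_natl _ (n * n)%N) natrM exprMn -expr2.
Qed.

Let variance n : \int[P]_w ((S n w - n%:R * p) ^+ 2)%:E <= (n%:R * p)%:E.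
Proof.
set c := (n%:R * p)%R; have c0 : (0 <= c)%R by rewrite mulr_ge0.
have mV : measurable_fun setT (fun w => ((S n w - c) ^+ 2)%:E).
  by apply/measurable_EFinP; apply: measurable_funX; exact: measurable_funB.
have : \int[P]_w ((S n w - c) ^+ 2)%:E + \int[P]_w (2 * c * S n w)%:E =
       \int[P]_w (S n w ^+ 2)%:E + \int[P]_w (c ^+ 2)%:E.
  rewrite -!ge0_integralD//.
  - apply: eq_integral => w _; rewrite -!EFinD; congr EFin; ring.
  - by move=> w _; rewrite lee_fin sqr_ge0.
  - by apply/measurable_EFinP; apply: measurable_funX.
  - by move=> w _; rewrite lee_fin sqr_ge0.
  - by move=> w _; rewrite lee_fin sqr_ge0.
  - by move=> w _; rewrite lee_fin mulr_ge0// mulr_ge0.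
  - by apply/measurable_EFinP; apply: measurable_funM.
have -> : \int[P]_w (2 * c * S n w)%:E = (2 * c ^+ 2)%:E.
  under eq_integral do rewrite EFinM.
  rewrite ge0_integralZl_EFin//; last 3 first.
  - by move=> w _; rewrite lee_fin.
  - exact/measurable_EFinP.
  - by rewrite mulr_ge0.
  by rewrite intS -EFinM -/c; congr EFin; ring.
have -> : \int[P]_w (c ^+ 2)%:E = (c ^+ 2)%:E.
  rewrite (integral_cst P measurableT).
  exact: etrans (congr1 _ (probability_setT P)) (mule1 _).
move=> eqV; rewrite -(@leeD2rE _ (2 * c ^+ 2)%:E)// eqV.
apply: (le_trans (leeD2r _ (intS2 n))); rewrite -/c -!EFinD lee_fin.
by rewrite le_eqVlt; apply/orP; left; apply/eqP; ring.
Qed.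

Let deviation (j : nat) : set O :=
  [set w | 2 ^- j <= `|S (8 ^ j) w / (8 ^ j)%:R - p|]%R.

Let mdeviation j : measurable (deviation j).
Proof.
apply: measurable_le_set => //; apply: measurableT_comp => //.
by apply: measurable_funB => //; apply: measurable_funM.
Qed.

Let P_deviation j : P (deviation j) <= (p * 2 ^- j)%:E.
Proof.
pose n : R := (8 ^ j)%:R; pose e : R := (2 ^- j)%R.
have n0 : (0 < n)%R by rewrite ltr0n expn_gt0.
have e0 : (0 < e)%R by rewrite invr_gt0 exprn_gt0.
have ne0 : (0 < (n * e) ^+ 2)%R by rewrite exprn_gt0// mulr_gt0.
have mV : measurable_fun setT (fun w => ((S (8 ^ j) w - n * p) ^+ 2)%:E).
  by apply/measurable_EFinP; apply: measurable_funX; exact: measurable_funB.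
have := le_integral_abse P measurableT mV ne0.
have -> : setT `&` [set w | ((n * e) ^+ 2)%:E <= `|((S (8 ^ j) w - n * p) ^+ 2)%:E|] =
    deviation j.
  rewrite setTI; apply/seteqP.
  suff H w : (((n * e) ^+ 2)%:E <= `|((S (8 ^ j) w - n * p) ^+ 2)%:E|) =
     (e <= `|S (8 ^ j) w / n - p|)%R by split => w; rewrite /deviation /= H.
  have -> : (S (8 ^ j) w - n * p = n * (S (8 ^ j) w / n - p))%R.
    by rewrite mulrBr mulrCA divff ?mulr1 ?gt_eqF.
  rewrite gee0_abs ?lee_fin ?sqr_ge0// !exprMn ler_pM2l ?exprn_gt0//.
  by rewrite -[in LHS](real_normK (num_real (S _ w / n - p))) ler_pXn2r// nnegrE ltW.
under eq_integral do rewrite gee0_abs ?lee_fin ?sqr_ge0//.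
move=> /le_trans/(_ (variance _)); rewrite -/n.
rewrite muleC -lee_pdivlMr// => /le_trans; apply.
rewrite -EFinM lee_fin le_eqVlt; apply/orP; left; apply/eqP.
have -> : (n = (2 ^+ j) ^+ 3)%R by rewrite /n natrX -exprM mulnC exprM -[in RHS]natrX.
by rewrite /e; field; rewrite expf_neq0.
Qed.

Lemma lln_subsequence :
  P [set w | limit_from_above (fun j => (S (8 ^ j) w / (8 ^ j)%:R)%R) != p] = 0.
Proof.
have lim0 : P (lim_sup_set deviation) = 0.
  apply: lim_sup_set_cvg0 => //.
  apply: (@le_lt_trans _ _ (\sum_(0 <= j <oo) (2 * p / (2 ^ j.+1)%:R)%:E)).
    apply: lee_nneseries => // j _; apply: (le_trans (P_deviation j)).
    rewrite lee_fin natrX exprS le_eqVlt; apply/orP; left; apply/eqP; field.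
    by rewrite expf_neq0.
  apply: (le_lt_trans (epsilon_trick0 xpredT _) (ltry _)).
  by rewrite mulr_ge0.
have mlim : measurable (lim_sup_set deviation).
  by apply: bigcapT_measurable => n; apply: bigcup_measurable.
have mbad : measurable
    [set w | limit_from_above (fun j => (S (8 ^ j) w / (8 ^ j)%:R)%R) != p].
  apply: measurable_neq_set => //.
  by apply: measurable_limit_from_above => j; exact: measurable_funM.
apply/eqP; rewrite eq_le measure_ge0 andbT -lim0; apply: le_measure; rewrite ?inE//.
move=> w /= /eqP wp n _; apply: contrapT => h; apply: wp.
apply: limit_from_aboveE; exists n => j nj; rewrite ltNge; apply/negP => dev.
by apply: h; exists j.
Qed.

End law_of_large_numbers.

(** * Conditional probabilities of a joining generate T-factors *)

Section systems.
Variables (R : realType) (dX dY : measure_display).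
Variables (X : measurableType dX) (Y : measurableType dY).
Variables (mu : probability X R) (T : X -> X) (nu : probability Y R) (S : Y -> Y).
Hypothesis aT : automorphism mu T.
Hypothesis aS : automorphism nu S.

(** The same sampler is run infinitely often with fresh noise.  Given [y] the
    events that the k-th sample is in [A] are independent of probability
    [cond_law psi y A], so this number is the limit of their frequencies: a
    function of [y] is thereby a function of a joining of copies of [T]. *)
Lemma cond_law_T_factor (I : countType) (psi : Y * R -> power_space I X)
    (A : set (power_space I X)) :
  sampler mu T nu S psi -> measurable A ->
  exists F : set (set Y), T_factor_sigma_algebra mu T nu S F /\
    forall D, measurable D -> F ((fun y => cond_law psi y A) @^-1` D).
Proof.
move=> psiP mA; have [mpsi _ _] := psiP.
have [V iidV] := exists_iid_uniform R.
pose I_ (k : nat) := I; pose psi_ (k : nat) : Y * R -> power_space (I_ k) X := psi.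
pose avg (j : nat) (x : power_space {k : nat & I_ k} X) : R :=
  ((\sum_(k < 8 ^ j) \1_A (block k x)) / (8 ^ j)%:R)%R.
have mavg j : measurable_fun setT (avg j).
  apply: measurable_funM => //; apply: measurable_sum => k.
  apply: (measurableT_comp (f := (\1_A : _ -> R)) (measurable_indic mA)).
  exact: measurable_block.
apply: (@T_factor_of_samplers R dX dY X Y mu T nu S aT aS I_ V psi_ _
  (fun x => limit_from_above (avg ^~ x)) iidV (fun=> psiP)).
- exact: measurable_cond_law.
- exact: measurable_limit_from_above.
rewrite /product_measure1; apply: integral0_eq => y _ /=.
pose B : set R := [set u | A (psi (y, u))].
have mB : measurable B := measurable_section mpsi y mA.
have PB : unif R B = (cond_law psi y A)%:E by rewrite (cond_lawE mpsi y mA).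
have := @lln_subsequence R _ R (unif R) (fun k => V k @^-1` B) (cond_law psi y A).
move=> lln; rewrite -[RHS]lln.
- congr (unif R _); apply/seteqP.
  have E u : (fun j => avg j (joined V psi_ (y, u)).1) =
     (fun j => (\sum_(k < 8 ^ j) \1_(V k @^-1` B) u) / (8 ^ j)%:R)%R.
    by [].
  by split=> u; rewrite /xsection/= inE/= -(E u).
- by move=> k; apply: measurable_preimage => //; exact: iidV.1.
- by move=> k; rewrite iid_uniform_law.
- by move=> i j ij; rewrite iid_uniform_law2// PB.
Qed.

(** A joining of [T] and [S] is a joining of the power of [T] with exponent
    [unit] and of the trivial factor [Y] of [S] itself. *)
Lemma joining_sampler (la : probability (X * Y)%type R) :
  coded R X -> joining mu T nu S la ->
  exists psi : Y * R -> power_space unit X, sampler mu T nu S psi /\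
    forall A C, measurable A -> measurable C ->
      (nu \x unif R) [set p | A (psi p tt) /\ C p.1] = la (fst @^-1` A `&` snd @^-1` C).
Proof.
move=> cX [la1 la2 la_inv].
pose f (p : X * Y) : power_space unit X * Y := (fun=> p.1, p.2).
have mf : measurable_fun setT f.
  apply: measurable_fun_pair; last exact: measurable_snd.
  by apply: measurable_fun_power => i; exact: measurable_fst.
have [la' la'E] := image_probability la mf.
have [||||psi [psiP psiE]] :=
  @noise_sampler R dX dY X Y mu T nu S aT unit dY Y nu S idfun la' cX aS.
- by split=> //; exact: measurable_id.
- by move=> i A mA; rewrite la'E -la1.
- by move=> C mC; rewrite la'E -la2.
- move=> D mD; rewrite !la'E -[RHS]la_inv//.
  exact: measurable_preimage.
exists psi; split=> // A C mA mC.
rewrite (psiE _ _ (measurable_cylinder tt mA) mC) la'E.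
by [].
Qed.

Lemma integral_cond_law_joining (la : probability (X * Y)%type R)
    (psi : Y * R -> power_space unit X) (A : set X) (C : set Y) :
  measurable_fun setT psi ->
  (forall A C, measurable A -> measurable C ->
      (nu \x unif R) [set p | A (psi p tt) /\ C p.1] = la (fst @^-1` A `&` snd @^-1` C)) ->
  measurable A -> measurable C ->
  \int[nu]_(y in C) (cond_law psi y [set x | A (x tt)])%:E =
  la (fst @^-1` A `&` snd @^-1` C).
Proof.
move=> mpsi psiE mA mC; rewrite -psiE//.
exact: (integral_cond_law mpsi nu (measurable_cylinder tt mA) mC).
Qed.

End systems.

(** A function that is measurable modulo null sets with respect to a factor
    sigma-algebra is a function on the factor: each level set [f < q] agrees up
    to a null set with the preimage of some [C q], and [h] is the cut defined by
    the sets [C q]. *)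
Lemma factor_through_mod (R : realType) dY dZ (Y : measurableType dY)
    (Z : measurableType dZ) (nu : probability Y R) (pi : Y -> Z)
    (F : set (set Y)) (f : Y -> R) :
  measurable_fun setT pi -> measurable_fun setT f -> (forall y, 0 <= f y <= 1)%R ->
  sub_mod nu F (preimage_set_system setT pi measurable) ->
  (forall D, measurable D -> F (f @^-1` D)) ->
  exists h : Z -> R, [/\ measurable_fun setT h, forall z, (0 <= h z <= 1)%R &
    ae_eq nu setT f (h \o pi)].
Proof.
move=> mpi mf f01 FG Ff.
have /choice[C CP] : forall q : rat, exists C : set Z, measurable C /\
    nu ((f @^-1` [set x | x < ratr q]%R `\` pi @^-1` C) `|`
        (pi @^-1` C `\` f @^-1` [set x | x < ratr q]%R)) = 0.
  move=> q; have mq : measurable [set x : R | x < ratr q]%R.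
    by rewrite -set_itvNyo; exact: measurable_itv.
  have [_ [C mC <-] CE] := FG _ (Ff _ mq).
  by exists C; split=> //; rewrite setTI in CE.
pose h0 z := real_of_cut R [set q | C q z].
have mh0 : measurable_fun setT h0.
  by apply: measurable_real_of_cut => q; exact: (CP q).1.
(* off the image of [pi] nothing is known of [h0], hence the truncation *)
exists (fun z => Num.max 0 (Num.min (h0 z) 1))%R; split.
- apply: measurable_maxr => //; exact: measurable_minr.
- by move=> z; rewrite le_max lexx/= ge_max ler01 ge_min lexx orbT.
pose N k : set Y := if (unpickle k : option rat) is Some q then
   (f @^-1` [set x | x < ratr q]%R `\` pi @^-1` C q) `|`
        (pi @^-1` C q `\` f @^-1` [set x | x < ratr q]%R) else set0.
have N0 k : nu.-negligible (N k).
  rewrite /N; case: unpickle => [q|]; last exact: negligible_set0.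
  apply/negligibleP; last exact: (CP q).2.
  have m1 : measurable (f @^-1` [set x | x < ratr q]%R).
    by apply: measurable_preimage => //; rewrite -set_itvNyo; exact: measurable_itv.
  have m2 : measurable (pi @^-1` C q) by apply: measurable_preimage => //; exact: (CP q).1.
  by apply: measurableU; exact: measurableD.
have : nu.-negligible (\bigcup_k N k) by exact: negligible_bigcup.
apply: negligibleS => y /= h; apply: contrapT => nN; apply: h => _.
have Cq q : C q (pi y) <-> (f y < ratr q)%R.
  have nNq : ~ N (pickle q) y by move=> Ny; apply: nN; exists (pickle q).
  split=> H; apply: contrapT => nH; apply: nNq; rewrite /N pickleK.
    by right.
  by left.
have -> : h0 (pi y) = f y.
  apply: real_of_cutE => q /=; first by move/Cq.
  by move/Cq/ltW.
by have /andP[f0 f1] := f01 y; rewrite min_l// max_r.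
Qed.

(** * Conditional independence over a factor *)

(** Off [B] the restricted measure vanishes, and on [B] it is [P]. *)
Lemma ge0_integral_mrestr (R : realType) d (O : measurableType d)
    (P : {measure set O -> \bar R}) (B D : set O) (mB : measurable B) (g : O -> \bar R) :
  measurable D -> measurable_fun D g -> (forall w, 0 <= g w) ->
  \int[mrestr P mB]_(w in D) g w = \int[P]_(w in D `&` B) g w.
Proof.
move=> mD mg g0.
have mDB : measurable (D `&` B) by exact: measurableI.
have mDnB : measurable (D `\` B) by exact: measurableD.
rewrite -{1}(setUIDK D B) ge0_integral_setU//; last 2 first.
- by rewrite setUIDK.
- by apply/disj_set2P/seteqP; split => w // [[_ Bw] [_ /(_ Bw)]].
rewrite [X in _ + X](_ : _ = 0) ?adde0.
  by apply: eq_measure_integral => A mA ADB; rewrite /= /mrestr; congr (P _);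
    apply/setIidl => w /ADB[].
transitivity (\int[mrestr P mB]_(w in D `\` B) cst 0 w); last exact: integral0.
apply: ge0_ae_eq_integral => //.
  by apply: measurable_funS mg => //; exact: subDsetl.
apply: ae_eq0 => //; rewrite /= /mrestr (_ : _ `&` _ = set0) ?measure0//.
by apply/seteqP; split => w // [[_ nB] /nB].
Qed.

Section conditional_independence.
Variables (R : realType) (dX dY dZ : measure_display).
Variables (X : measurableType dX) (Y : measurableType dY) (Z : measurableType dZ).
Variables (nu : probability Y R) (rho : probability Z R) (pi : Y -> Z).
Variable la : probability (X * Y)%type R.
Hypothesis mpi : measurable_fun setT pi.
Hypothesis piE : forall C, measurable C -> nu (pi @^-1` C) = rho C.
Hypothesis la2 : forall B, measurable B -> la (snd @^-1` B) = nu B.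

Let G : set (set (X * Y)) :=
  preimage_set_system setT snd (preimage_set_system setT pi measurable).

Let mpi2 : measurable_fun setT (fun p : X * Y => pi p.2).
Proof. exact: (measurableT_comp mpi measurable_snd). Qed.

Let la_pi C : measurable C -> la ((fun p : X * Y => pi p.2) @^-1` C) = rho C.
Proof.
move=> mC; rewrite -piE// -la2//; exact: measurable_preimage.
Qed.

(** A function of [pi] is measurable for the factor sigma-algebra [G], and the
    sets of [G] are the preimages of sets of [Z]; so the defining equations of a
    conditional probability can be checked on [Z]. *)
Lemma cond_prob_of_density (E : set (X * Y)) (k : Z -> R) :
  measurable E -> measurable_fun setT k -> (forall z, (0 <= k z)%R) ->
  (forall C, measurable C ->
     \int[rho]_(z in C) (k z)%:E = la (E `&` (fun p => pi p.2) @^-1` C)) ->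
  cond_prob la G E (fun p => k (pi p.2)).
Proof.
move=> mE mk k0 kE.
have mEk : measurable_fun setT (fun z => (k z)%:E) by exact/measurable_EFinP.
have intE C : measurable C -> \int[la]_(p in (fun p => pi p.2) @^-1` C) (k (pi p.2))%:E =
    la (E `&` (fun p => pi p.2) @^-1` C).
  move=> mC; rewrite -kE//; apply/esym.
  apply: (ge0_integral_image mpi2 la_pi mC (g := fun z => (k z)%:E)).
    exact: measurable_funTS.
  by move=> z _; rewrite lee_fin.
split.
- move=> _ [D mD <-]; exists (pi @^-1` (k @^-1` D)); last by rewrite !setTI.
  by exists (k @^-1` D); [exact: measurable_preimage|rewrite setTI].
- apply/integrableP; split; first exact: (measurableT_comp mEk mpi2).
  under eq_integral do rewrite gee0_abs ?lee_fin//.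
  rewrite -(preimage_setT (fun p : X * Y => pi p.2)) intE//.
  apply: (le_lt_trans (probability_le1 la _) (ltry _)).
  by apply: measurableI => //; exact: measurable_preimage.
- by move=> _ [_ [D mD <-] <-]; rewrite !setTI; exact: intE.
Qed.

(** Suppose the conditional probability [f] of [A] given [Y] is the function
    [h \o pi] of the factor.  With [H] the conditional probability of [B] given
    [Z], the measure of [A * B] over a set [C] of [Z] is the integral of
    [h \o pi] over the part of [B] above [C], and conditioning on [Z] turns this
    into the integral of [h * H] over [C]: the conditional probability of
    [A * B] factorises. *)
Lemma cond_independent_of_factor (A : set X) (B : set Y) (f : Y -> R) (h : Z -> R) :
  measurable A -> measurable B ->
  measurable_fun setT f -> (forall y, 0 <= f y)%R ->
  (forall C, measurable C -> \int[nu]_(y in C) (f y)%:E =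
     la (fst @^-1` A `&` snd @^-1` C)) ->
  measurable_fun setT h -> (forall z, 0 <= h z)%R ->
  ae_eq nu setT f (h \o pi) ->
  exists f1 f2 f12 : X * Y -> R,
    [/\ cond_prob la G (fst @^-1` A) f1, cond_prob la G (snd @^-1` B) f2,
        cond_prob la G (fst @^-1` A `&` snd @^-1` B) f12 &
        {ae la, forall x, f12 x = (f1 x * f2 x)%R}].
Proof.
move=> mA mB mf f0 fE mh h0 fh.
have mA1 : measurable (fst @^-1` A : set (X * Y)) by exact: measurable_preimage.
have mB2 : measurable (snd @^-1` B : set (X * Y)) by exact: measurable_preimage.
have mEh : measurable_fun setT (fun z => (h z)%:E) by exact/measurable_EFinP.
have mEf : measurable_fun setT (fun y => (f y)%:E) by exact/measurable_EFinP.
have mEhpi : measurable_fun setT (fun y => (h (pi y))%:E).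
  exact: (measurableT_comp mEh mpi).
have hE C : measurable C -> \int[nu]_(y in C) (h (pi y))%:E =
     la (fst @^-1` A `&` snd @^-1` C).
  move=> mC; rewrite -fE//; apply: ge0_ae_eq_integral => //.
  - exact: measurable_funTS.
  - exact: measurable_funTS.
  - by move=> y _; rewrite lee_fin.
  - by move=> y _; rewrite lee_fin.
  - by move: fh; apply: filterS => y /= /(_ I) -> _.
have [m mE] := image_restr_measure nu mpi mB.
have m_le C : measurable C -> m C <= rho C.
  move=> mC; rewrite mE -piE//; apply: le_measure; rewrite ?inE.
  - by apply: measurableI => //; exact: measurable_preimage.
  - exact: measurable_preimage.
  - exact: subIsetl.
have [H [mH H0 HE]] := dominated_density m_le.
exists (fun p => h (pi p.2)), (fun p => H (pi p.2)), (fun p => h (pi p.2) * H (pi p.2))%R.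
split.
- apply: cond_prob_of_density => // C mC.
  rewrite (ge0_integral_image mpi piE mC (g := fun z => (h z)%:E)); last 2 first.
  + exact: measurable_funTS.
  + by move=> z _; rewrite lee_fin.
  by rewrite hE//; exact: measurable_preimage.
- apply: cond_prob_of_density => // C mC.
  have mCB : measurable (pi @^-1` C `&` B).
    by apply: measurableI => //; exact: measurable_preimage.
  transitivity (m C).
    have := HE (cst 1) C mC (measurable_cst _) (fun=> lee01).
    rewrite integral_cst// mul1e => <-.
    by apply: eq_integral => z _; rewrite mul1e.
  rewrite mE; apply: etrans (esym (la2 mCB)) _; congr (la _).
  by apply/seteqP; split => p /= [].
- apply: (cond_prob_of_density (k := fun z => (h z * H z)%R)).
  + exact: measurableI.
  + exact: measurable_funM.
  + by move=> z; rewrite mulr_ge0.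
  move=> C mC; under eq_integral do rewrite EFinM.
  rewrite HE//; last exact: measurable_funTS.
  have mC' : measurable (pi @^-1` C) by exact: measurable_preimage.
  transitivity (\int[mrestr nu mB]_(y in pi @^-1` C) (h (pi y))%:E).
    apply: (ge0_integral_image mpi _ mC (g := fun z => (h z)%:E)).
    * by move=> D mD; rewrite mE.
    * exact: measurable_funTS.
    * by move=> z _; rewrite lee_fin.
  rewrite ge0_integral_mrestr//; last 2 first.
  + exact: measurable_funTS.
  + by move=> y; rewrite lee_fin.
  rewrite hE; last exact: measurableI.
  congr (la _); apply/seteqP; split => p /=; first by move=> [? []].
  by move=> [[]].
- exact: aeW.
Qed.

End conditional_independence.

(** * Existence of the maximum T-factor sigma-algebra *)

Definition symdiff (Y : Type) (A B : set Y) : set Y := (A `\` B) `|` (B `\` A).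

Lemma measurable_symdiff d (Y : measurableType d) (A B : set Y) :
  measurable A -> measurable B -> measurable (symdiff A B).
Proof. by move=> mA mB; apply: measurableU; exact: measurableD. Qed.

Lemma symdiff_triangle (R : realType) d (Y : measurableType d)
    (nu : probability Y R) (A B C : set Y) :
  measurable A -> measurable B -> measurable C ->
  nu (symdiff A C) <= nu (symdiff A B) + nu (symdiff B C).
Proof.
move=> mA mB mC.
have mAB := measurable_symdiff mA mB; have mBC := measurable_symdiff mB mC.
apply: (le_trans _ (measureU2 nu mAB mBC)).
apply: le_measure; rewrite ?inE.
- exact: measurable_symdiff.
- exact: measurableU.
move=> y [[Ay nC]|[Cy nA]]; have [By|nB] := pselect (B y).
- by right; left.
- by left; left.
- by left; right.
- by right; right.
Qed.

Section countable_dense.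
Variables (R : realType) (d : measure_display) (Y : measurableType d).
Variables (nu : probability Y R) (G : nat -> set Y).
Hypothesis mG : forall i, measurable (G i).

(** Finite boolean combinations of the [G n], written with the single n-ary
    connective complement of the union, so that finite trees, which form a
    countable type, index the algebra generated by the [G n]. *)
Fixpoint boolean_combination (t : GenTree.tree nat) : set Y :=
  match t with
  | GenTree.Leaf n => G n
  | GenTree.Node _ ts => ~` (foldr (fun t A => boolean_combination t `|` A) set0 ts)
  end.

Lemma measurable_boolean_combination t : measurable (boolean_combination t).
Proof.
elim/GenTree.tree_ind: t => [n|n ts IH] /=; first exact: mG.
apply: measurableC; elim: ts IH => [_|t ts IHts [mt mts]] /=; first exact: measurable0.
by apply: measurableU => //; exact: IHts.
Qed.

(** The closure of the generated algebra for the distance of [symdiff]. *)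
Definition approximable (B : set Y) : Prop := measurable B /\
  forall eps : R, (0 < eps)%R ->
    exists t, nu (symdiff B (boolean_combination t)) < eps%:E.

Lemma approximableC B : approximable B -> approximable (~` B).
Proof.
move=> [mB hB]; split; first exact: measurableC.
move=> eps /hB[t ht]; exists (GenTree.Node 0 [:: t]); congr (nu _ < _): ht.
by rewrite /= setU0 /symdiff !setDE !setCK setUC [X in _ = X `|` _]setIC [X in _ = _ `|` X]setIC.
Qed.

Lemma approximable0 : approximable set0.
Proof.
split=> // eps eps0; exists (GenTree.Node 0 [:: GenTree.Node 0 [::]]).
by rewrite /= setC0 setU0 setCT /symdiff !set0D setU0 measure0 lte_fin.
Qed.

Lemma approximable_gen i : approximable (G i).
Proof.
split=> // eps eps0; exists (GenTree.Leaf i).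
by rewrite /symdiff setDv setU0 measure0 lte_fin.
Qed.

Lemma approximableU A B : approximable A -> approximable B -> approximable (A `|` B).
Proof.
move=> [mA hA] [mB hB]; split; first exact: measurableU.
move=> eps eps0; have eps2 : (0 < eps / 2)%R by rewrite divr_gt0.
have [t ht] := hA _ eps2; have [t' ht'] := hB _ eps2.
exists (GenTree.Node 0 [:: GenTree.Node 0 [:: t; t']]).
rewrite /= !setU0 setCK.
have m1 := measurable_symdiff mA (measurable_boolean_combination t).
have m2 := measurable_symdiff mB (measurable_boolean_combination t').
apply: (@le_lt_trans _ _ (nu (symdiff A (boolean_combination t)) +
   nu (symdiff B (boolean_combination t')))); last by rewrite [eps]splitr EFinD lteD.
apply: (le_trans _ (measureU2 nu m1 m2)); apply: le_measure; rewrite ?inE.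
- apply: measurable_symdiff; apply: measurableU => //;
    exact: measurable_boolean_combination.
- exact: measurableU.
move=> y [[[Ay|By] nD]|[[Dy|Dy] nAB]].
- by left; left; split=> // Dy; apply: nD; left.
- by right; left; split=> // Dy; apply: nD; right.
- by left; right; split=> // Ay; apply: nAB; left.
- by right; right; split=> // Ay; apply: nAB; right.
Qed.

Lemma approximable_bigcup (F : nat -> set Y) :
  (forall n, approximable (F n)) -> approximable (\bigcup_n F n).
Proof.
move=> hF; have mF n : measurable (F n) := (hF n).1.
have mU : measurable (\bigcup_n F n) by exact: bigcupT_measurable.
split=> // eps eps0; have eps2 : (0 < eps / 2)%R by rewrite divr_gt0.
pose U N := \big[setU/set0]_(i < N) F i.
have hU N : approximable (U N).
  rewrite /U; elim: N => [|N IH]; first by rewrite big_ord0; exact: approximable0.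
  by rewrite big_ord_recr; exact: approximableU.
have mUN N : measurable (U N) := (hU N).1.
have sub N : U N `<=` \bigcup_n F n by exact: bigsetU_bigcup.
have [N hN] : exists N, nu ((\bigcup_n F n) `\` U N) < (eps / 2)%:E.
  have cv : nu ((\bigcup_n F n) `\` U n) @[n --> \oo] -->
      nu (\bigcap_n ((\bigcup_n F n) `\` U n)).
    apply: nonincreasing_cvg_mu.
    - apply: (le_lt_trans (probability_le1 nu _) (ltry _)); exact: measurableD.
    - by move=> n; exact: measurableD.
    - by apply: bigcapT_measurable => n; exact: measurableD.
    - move=> n m nm; apply/subsetPset; apply: setDS.
      exact: subset_bigsetU nm.
  rewrite (_ : \bigcap_n _ = set0) in cv; last first.
    apply/seteqP; split => // y h; have [[n _ Fy] _] := h 0%N I.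
    by have [_] := h n.+1 I; apply; rewrite /U big_ord_recr; right.
  rewrite measure0 in cv.
  have /fine_cvgP[fin /cvgrPdist_lt/(_ _ eps2)[M _ hM]] := cv.
  have [K _ hK] := fin; exists (maxn K M).
  have := hM _ (leq_maxr K M); rewrite /= sub0r normrN.
  rewrite ger0_norm ?fine_ge0// -lte_fin fineK//.
  exact: (hK _ (leq_maxl K M)).
have [_ /(_ _ eps2)[t ht]] := hU N; exists t.
apply: (le_lt_trans (symdiff_triangle nu mU (mUN N) (measurable_boolean_combination t))).
rewrite [eps]splitr EFinD; apply: lteD => //.
rewrite /symdiff (_ : U N `\` _ = set0) ?setU0//.
by apply/seteqP; split => y // [/sub].
Qed.

(** The approximable sets form a sigma-algebra, so the countable algebra is dense
    in everything it generates. *)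
Lemma approximable_generated B : <<s range G >> B -> approximable B.
Proof.
move: B; apply: smallest_sub; last by move=> _ [i _ <-]; exact: approximable_gen.
split; first exact: approximable0.
- by move=> B; rewrite setTD; exact: approximableC.
- exact: approximable_bigcup.
Qed.

End countable_dense.

(** The preimages of the rays with rational end points generate, because the
    code is injective with a measurable inverse. *)
Lemma coded_generated (R : realType) d (Y : measurableType d) : coded R Y ->
  exists G : nat -> set Y, (forall i, measurable (G i)) /\
    forall B, measurable B -> <<s range G >> B.
Proof.
move=> [e [r [me mr eK _]]].
pose G i : set Y := if (unpickle i : option rat) is Some q
  then [set y | e y < ratr q]%R else set0.
exists G; split.
  move=> i; rewrite /G; case: unpickle => // q.
  by apply: measurable_lt_set => //; exact: measurable_cst.
pose O : measurableType _ := g_sigma_algebraType (range G).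
have meO : measurable_fun setT (e : O -> R).
  apply: (measurability _ (RGenInftyO.measurableE R)).
  move=> _ [_ [x ->] <-]; rewrite setTI set_itvE.
  rewrite (_ : _ @^-1` _ = \bigcup_(q : rat) (if (ratr q < x)%R then G (pickle q) else set0)).
    apply: bigcupT_measurable_rat => q; case: ifP => _; last exact: measurable0.
    by apply: sub_sigma_algebra; exists (pickle q).
  apply/seteqP; split => y /=.
    move=> /rat_in_itvoo[q]; rewrite in_itv/= => /andP[eq qx]; exists q => //.
    by rewrite qx /G pickleK.
  move=> [q _]; case: ifP => // qx; rewrite /G pickleK /= => h; exact: lt_trans qx.
move=> B mB; have := meO measurableT _ (measurable_preimage mr mB).
rewrite setTI; congr (<<s range G >> _).
by apply/seteqP; split => y /=; rewrite eK.
Qed.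

Section maximum.
Variables (R : realType) (dX dY : measure_display).
Variables (X : measurableType dX) (Y : measurableType dY).
Variables (mu : probability X R) (T : X -> X) (nu : probability Y R) (S : Y -> Y).
Hypothesis aT : automorphism mu T.
Hypothesis aS : automorphism nu S.
Hypothesis cX : coded R X.
Hypothesis cY : coded R Y.

(** A sampler together with a set of outputs; bundled, because the index type
    varies with the sampler. *)
Record witness := Witness {
  wI : countType;
  wpsi : Y * R -> power_space wI X;
  wA : set (power_space wI X) }.

Definition mismatch (B : set Y) (w : witness) : set (Y * R) :=
  symdiff (@wpsi w @^-1` @wA w) (fst @^-1` B).

(** The event [y \in B] is almost surely an event about the sampled point. *)
Definition recovers (B : set Y) (w : witness) : Prop :=
  [/\ sampler mu T nu S (@wpsi w), measurable (@wA w), measurable B &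
      (nu \x unif R) (mismatch B w) = 0].

(** A T-factor [Z] is a factor of a joining of copies of [T] through [q] and of
    [S] through [pi].  Sample a point of the joining conditionally on
    [q x = pi y]: then [q x] lies in [C] exactly when [pi y] does. *)
Lemma T_factor_recovered (F : set (set Y)) (B : set Y) :
  T_factor_sigma_algebra mu T nu S F -> F B -> exists w, recovers B w.
Proof.
move=> [dZ [Z [rho [Q [pi [[_ aQ] [_ [I [m [q [[m1 m2] [mq qE qQ]]]]]] facpi ->]]]]]].
have [mpi piE piS] := facpi.
move=> [C mC]; rewrite setTI => <-{B}.
have mB : measurable (pi @^-1` C) by exact: measurable_preimage.
pose f (x : power_space I X) : power_space I X * Z := (x, q x).
have mf : measurable_fun setT f by exact: measurable_fun_pair.
have [la laE] := image_probability m mf.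
have [|||psi [psiP psiE]] := @noise_sampler R dX dY X Y mu T nu S aT I dZ Z rho Q pi la cX aQ facpi.
- by move=> i A mA; rewrite laE -(m1 i A mA).
- by move=> D mD; rewrite laE -qE.
- move=> D mD; rewrite !laE -[RHS]m2; last exact: measurable_preimage.
  by congr (m _); apply/seteqP; split => x; rewrite /f /preimage/= qQ.
have mA : measurable (q @^-1` C) by exact: measurable_preimage.
exists (@Witness I psi (q @^-1` C)); split => //=.
have [mpsi _ _] := psiP.
have mA' : measurable (psi @^-1` (q @^-1` C)) by exact: measurable_preimage.
have mB' : measurable (fst @^-1` (pi @^-1` C) : set (Y * R)) by exact: measurable_preimage.
apply/eqP; rewrite eq_le measure_ge0 andbT /mismatch /symdiff /=.
apply: (le_trans (measureU2 _ (measurableD mA' mB') (measurableD mB' mA'))).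
rewrite -[leRHS]adde0; apply: leeD.
- have := psiE _ _ mA (measurableC mC).
  rewrite laE [RHS](_ : _ = 0); first by move=> h; rewrite le_eqVlt; apply/orP; left; apply/eqP.
  rewrite (_ : _ @^-1` _ = set0) ?measure0//.
  by apply/seteqP; split => x //= [].
- have := psiE _ _ (measurableC mA) mC.
  rewrite laE [RHS](_ : _ = 0).
    move=> h; rewrite le_eqVlt; apply/orP; left; apply/eqP; rewrite -[RHS]h.
    by congr (product_measure1 _ _ _); apply/seteqP; split => p /= [].
  rewrite (_ : _ @^-1` _ = set0) ?measure0//.
  by apply/seteqP; split => x //= [].
Qed.

(** The default entry of the dense sequence: the joining of no copies of [T]. *)
Lemma recovers_set0 : exists w, recovers set0 w.
Proof.
pose x0 : power_space void X := fun v => match v with end.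
pose psi (p : Y * R) : power_space void X := x0.
exists (@Witness void psi set0); split => //=.
- split; first exact: measurable_cst.
    by move=> [].
  move=> A mA; apply: aeW => y; rewrite /cond_law; congr (fine (unif R _)).
  apply/seteqP; split => u; rewrite /preimage /psi/=.
    by congr A; apply/funext => -[].
  by congr A; apply/funext => -[].
- by rewrite /mismatch /symdiff !preimage_set0 setD0 setU0 measure0.
Qed.

(** Recovered sets form a subset of a separable space.  For every element of the
    countable dense algebra and every rank [j], a recovered set within [1/(j+1)]
    of it is selected whenever there is one. *)
Lemma exists_dense_recovered : exists (B : nat -> set Y) (w : nat -> witness),
  (forall k, recovers (B k) (w k)) /\
  forall C w', recovers C w' -> forall eps : R, (0 < eps)%R ->
    exists k, nu (symdiff C (B k)) < eps%:E.
Proof.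
have [G [mG genG]] := coded_generated cY.
have [w0 hw0] := recovers_set0.
pose good (n : nat) (Bw : set Y * witness) := recovers Bw.1 Bw.2 /\
  (if (unpickle n : option (GenTree.tree nat * nat)) is Some (t, j) then
    (exists C w, recovers C w /\ nu (symdiff C (boolean_combination G t)) < (j.+1%:R^-1)%:E) ->
    nu (symdiff Bw.1 (boolean_combination G t)) < (j.+1%:R^-1)%:E
  else True).
have /choice[Bw BwP] : forall n, exists Bw, good n Bw.
  move=> n; rewrite /good; case: unpickle => [[t j]|]; last by exists (set0, w0).
  have [[C [w [hC CD]]]|nC] := pselect (exists C w, recovers C w /\
     nu (symdiff C (boolean_combination G t)) < (j.+1%:R^-1)%:E).
    by exists (C, w).
  by exists (set0, w0).
exists (fun n => (Bw n).1), (fun n => (Bw n).2); split.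
  by move=> n; have [] := BwP n.
move=> C w' hC eps eps0.
have eps2 : (0 < eps / 2)%R by rewrite divr_gt0.
have [j _ /(_ j (leqnn j)) /= hj] := near_infty_natSinv_lt (PosNum eps2).
have [_ _ mC _] := hC.
have [_ /(_ j.+1%:R^-1)%R[|t ht]] := approximable_generated nu mG (genG C mC).
  by rewrite invr_gt0.
exists (pickle (t, j)).
have [[_ _ mB _]] := BwP (pickle (t, j)); rewrite pickleK => /(_ _)/wrap[].
  by exists C, w'.
move=> hB.
have mD : measurable (boolean_combination G t).
  exact: measurable_boolean_combination.
apply: (le_lt_trans (symdiff_triangle nu mC mD mB)).
rewrite [eps]splitr EFinD; apply: lteD.
  by apply: (lt_trans ht); rewrite lte_fin.
rewrite (_ : symdiff _ _ = symdiff (Bw (pickle (t, j))).1 (boolean_combination G t)).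
  by apply: (lt_trans hB); rewrite lte_fin.
by rewrite /symdiff setUC.
Qed.

(** All the sets [B k] are recovered at once from independent runs of their
    samplers, so that the orbit process of [(B k)] is a T-factor.  Any set [A]
    of a T-factor sigma-algebra is within [2 ^- n.+1] of some [B (k n)], and by
    Borel-Cantelli it is almost surely the upper limit of the [B (k n)]. *)
Lemma exists_max_T_factor : exists F, max_T_factor_sigma_algebra mu T nu S F.
Proof.
have [B [w [hB dense]]] := exists_dense_recovered.
have mB k : measurable (B k) by have [] := hB k.
have mA k : measurable (@wA (w k)) by have [] := hB k.
have samp k : sampler mu T nu S (@wpsi (w k)) by have [] := hB k.
have mpsi k : measurable_fun setT (@wpsi (w k)) by have [] := samp k.
have mis k : (nu \x unif R) (mismatch (B k) (w k)) = 0 by have [] := hB k.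
have [V iidV] := exists_iid_uniform R.
pose g y : R := encode_family (fun k : nat => \1_(B k) y).
pose I_ k := wI (w k); pose psi k : Y * R -> power_space (I_ k) X := @wpsi (w k).
pose a (x : power_space {k : nat & I_ k} X) : R :=
  encode_family (fun k : nat => \1_(@wA (w k)) (block k x)).
have mg : measurable_fun setT g.
  by apply: measurable_encode_family => k; exact: measurable_indic.
have ma : measurable_fun setT a.
  apply: measurable_encode_family => k.
  apply: (measurableT_comp (f := (\1_(@wA (w k)) : _ -> R)) (measurable_indic (mA k))).
  exact: measurable_block.
have mmis k : measurable (mismatch (B k) (w k)).
  apply: measurable_symdiff; first exact: (measurable_preimage (@mpsi k) (mA k)).
  exact: (measurable_preimage measurable_fst (mB k)).
have ag : (nu \x unif R) [set p | a (joined V psi p).1 != g p.1] = 0.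
  pose N := \bigcup_k [set p : Y * R | mismatch (B k) (w k) (p.1, V k p.2)].
  have mN_ k : measurable [set p : Y * R | mismatch (B k) (w k) (p.1, V k p.2)].
    apply: (measurable_preimage (f := fun p : Y * R => (p.1, V k p.2)) _ (mmis k)).
    apply: measurable_fun_pair => //; exact: (measurableT_comp (iidV.1 k)).
  have N0 : (nu \x unif R) N = 0.
    apply: measure_negligible; first exact: bigcupT_measurable.
    apply: negligible_bigcup => k; apply/negligibleP => //.
    by rewrite -[RHS](mis k); exact: (joined_sample_law nu iidV k (mmis k)).
  apply/eqP; rewrite eq_le measure_ge0 andbT -N0; apply: le_measure; rewrite ?inE.
  - apply: measurable_neq_set.
      exact: (measurableT_comp ma (measurableT_comp measurable_fst (measurable_joined iidV mpsi))).
    exact: (measurableT_comp mg measurable_fst).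
  - exact: bigcupT_measurable.
  move=> p /= /eqP agp; apply: contrapT => nN; apply: agp.
  congr encode_family; apply/funext => k; rewrite !indicE; congr (_%:R); congr nat_of_bool.
  have nNk : ~ mismatch (B k) (w k) (p.1, V k p.2) by move=> h; apply: nN; exists k.
  apply/idP/idP; rewrite !inE => h; apply: contrapT => nh; apply: nNk.
    by left.
  by right.
have [F [TF Fg]] := T_factor_of_samplers aT aS iidV samp mg ma ag.
exists F; split=> // G TG A GA.
have [wA' hA] := T_factor_recovered TG GA; have [_ _ mA' _] := hA.
have FB k : F (B k).
  have := Fg _ (measurable_preimage (@measurable_decode_family R nat k) (measurable_set1 1%R)).
  congr F; apply/seteqP; split => y /=; rewrite /g encode_familyK indicE.
    by have [/set_mem//|_] := boolP (y \in B k); move/eqP; rewrite eq_sym oner_eq0.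
  by move=> By; rewrite mem_set.
have /choice[k hk] : forall n : nat, exists k, nu (symdiff A (B k)) < (1 / (2 ^ n.+1)%:R)%:E.
  by move=> n; apply: (dense _ _ hA); rewrite divr_gt0// ltr0n expn_gt0.
exists (lim_sup_set (B \o k)).
  have [dZ [Z [rho [Q [pi [_ _ _ FE]]]]]] := TF.
  have /choice[C CP] : forall n, exists C : set Z, measurable C /\ pi @^-1` C = B (k n).
    move=> n; have := FB (k n); rewrite FE => -[C mC <-].
    by exists C; rewrite setTI.
  rewrite FE; exists (lim_sup_set C).
    apply: bigcapT_measurable => n; apply: bigcup_measurable => j _; exact: (CP j).1.
  rewrite setTI /lim_sup_set preimage_bigcap; apply: eq_bigcapr => n _.
  by rewrite preimage_bigcup; apply: eq_bigcupr => j _; exact: (CP j).2.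
have mS n : measurable (symdiff A (B (k n))) by exact: measurable_symdiff.
have lim0 : nu (lim_sup_set (fun n => symdiff A (B (k n)))) = 0.
  apply: lim_sup_set_cvg0 => //.
  apply: (@le_lt_trans _ _ (\sum_(0 <= n <oo) (1 / (2 ^ n.+1)%:R)%:E)).
    by apply: lee_nneseries => // n _; apply: ltW; exact: hk.
  exact: (le_lt_trans (epsilon_trick0 xpredT ler01) (ltry _)).
have mlimB : measurable (lim_sup_set (B \o k)).
  by apply: bigcapT_measurable => n; apply: bigcup_measurable => j _; exact: mB.
apply/eqP; rewrite eq_le measure_ge0 andbT -[leRHS]lim0; apply: le_measure; rewrite ?inE.
- exact: (measurable_symdiff mA' mlimB).
- by apply: bigcapT_measurable => n; apply: bigcup_measurable.
move=> y [[Ay nlim]|[lim nA]] n _.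
  apply: contrapT => h; apply: nlim => m _.
  apply: contrapT => h'; apply: h; exists (maxn n m); first exact: leq_maxl.
  left; split=> // Bm; apply: h'; exists (maxn n m) => //; exact: leq_maxr.
have [j nj Bj] := lim n I; exists j => //; by right.
Qed.

End maximum.

(** * Maximum T-factor and relative independence *)

(* On X * Y, the preimages under fst and snd of sigma-algebras A on X and B on
   Y are A \otimes {set0, Y} and {set0, X} \otimes B. *)
Theorem theorem3p7 (R : realType) (dX dY : measure_display)
    (X : measurableType dX) (Y : measurableType dY)
    (mu : probability X R) (T : X -> X) (nu : probability Y R) (S : Y -> Y)
    (hT : dynamical_system mu T) (hS : dynamical_system nu S) :
  (exists FT : set (set Y), max_T_factor_sigma_algebra mu T nu S FT) /\
  (forall FT : set (set Y), max_T_factor_sigma_algebra mu T nu S FT ->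
   forall la : probability (X * Y)%type R, joining mu T nu S la ->
     cond_independent la
       (preimage_set_system setT fst (measurable : set (set X)))
       (preimage_set_system setT snd (measurable : set (set Y)))
       (preimage_set_system setT snd FT)).
Proof.
have [/standard_borel_coded cX aT] := hT; have [/standard_borel_coded cY aS] := hS.
split; first exact: exists_max_T_factor.
move=> FT [[dZ [Z [rho [Q [pi [_ _ [mpi piE _] FTE]]]]]] FTmax] la la_joining.
have [_ la2 _] := la_joining.
have [psi [psiP psiE]] := joining_sampler aT aS cX la_joining.
have [mpsi _ _] := psiP.
move=> _ _ [A mA <-] [B mB <-]; rewrite !setTI FTE.
have mAtt := measurable_cylinder tt mA.
have [F [TF Ff]] := cond_law_T_factor aT aS psiP mAtt.
have mf := measurable_cond_law mpsi mAtt.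
have f01 y := cond_law_itv mpsi y mAtt.
have f0 y : (0 <= cond_law psi y ((fun x : power_space unit X => x tt) @^-1` A))%R.
  by have /andP[] := f01 y.
(* the only use of maximality: the conditional probability of [A] is measurable
   for the maximum T-factor *)
have FFT := FTmax F TF; rewrite FTE in FFT.
have [h [mh h01 fh]] := factor_through_mod mpi mf f01 FFT Ff.
have h0 z : (0 <= h z)%R by have /andP[] := h01 z.
apply: (cond_independent_of_factor mpi piE la2 mA mB mf f0 _ mh h0 fh).
by move=> C mC; exact: integral_cond_law_joining.
Qed.
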